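(* Let $\Phi\subset\mathbb{R}^3$ be a ruled $C^3$-surface, free of torsal rulings, which is relatively normalized by ${}^{(\alpha)}\bar y$ with $\alpha\in\mathbb{R}\setminus\{1/4\}$. Assume that the Tchebychev vectors ${}^{(\alpha)}\bar T$ are tangent to the orthogonal trajectories of the curves of constant striction distance, or to the orthogonal trajectories of the $K$-curves, or tangent to one family of (Euclidean) lines of curvature. Then $\Phi$ is an Edlinger surface.
   Context: Ruled surfaces. Let $I\subset\mathbb{R}$ be an open interval and $U=I\times\mathbb{R}$. A ruled surface $\Phi$ free of torsal rulings is parametrized over $U$ by the (injective) immersion $\bar x(u,v)=\bar s(u)+v\,\bar e(u)$ with $|\bar e|=|\bar e'|=1$ and $\langle\bar s',\bar e'\rangle=0$ on $I$ (so $\bar s$ is the line of striction, $u$ is arc length of the spherical curve $\bar e$); a prime denotes $d/du$. For a $C^3$-surface $\bar s,\bar e$ are of class $C^3$. The moving frame is $\bar e$, $\bar n=\bar e'$, $\bar z=\bar e\times\bar n$. The fundamental invariants are: conical curvature $\kappa=\det(\bar e,\bar e',\bar e'')$, parameter of distribution $\delta=\det(\bar s',\bar e,\bar e')$, and $\lambda$, defined by $\bar s'=\delta(\lambda\bar e+\bar z)$. Free of torsal rulings (skew) means $\delta(u)\ne0$ for all $u\in I$. Edlinger surface: a ruled surface whose osculating quadrics (limits, along each ruling, of the quadric through three neighbouring rulings) are rotational hyperboloids; equivalently, a ruled surface with constant parameter of distribution whose line of striction is a line of curvature, i.e. $\delta'=0$ and $1+\kappa\lambda=0$ on $I$. Relative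 normalization. Put $u^1=u$, $u^2=v$. Let $\bar\xi=(\bar x_u\times\bar x_v)/|\bar x_u\times\bar x_v|$ be the Euclidean unit normal, $h_{ij}=\langle\bar\xi,\partial^2\bar x/\partial u^i\partial u^j\rangle$ the second fundamental form with inverse $h^{(ij)}$, and $K$ the Gaussian curvature ($K=-\delta^2/(v^2+\delta^2)^2\neq0$). For $\alpha\in\mathbb{R}$ put $q={}^{(\alpha)}q=|K|^\alpha$ (support function); the relative normalization it determines is ${}^{(\alpha)}\bar y=-h^{(ij)}\frac{\partial q}{\partial u^i}\frac{\partial\bar x}{\partial u^j}+q\,\bar\xi$ (summation over repeated indices). The relative metric is $G_{ij}=q^{-1}h_{ij}$, with inverse $G^{ij}$; indices are raised and lowered with $G$. The symmetric Darboux tensor is $$A_{jkl}=\frac1q\Big\langle\bar\xi,\frac{\partial^3\bar x}{\partial u^j\partial u^k\partial u^l}\Big\rangle-\frac12\Big(\frac{\partial G_{jk}}{\partial u^l}+\frac{\partial G_{kl}}{\partial u^j}+\frac{\partial G_{lj}}{\partial u^k}\Big).$$ The Tchebychev vector is ${}^{(\alpha)}\bar T=T^i\,\partial\bar x/\partial u^i$ with $T_i=\frac12A_{ijk}G^{jk}$, $T^i=G^{ij}T_j$. Curves. The curves of constant striction distance are the curves $v=\text{const}$. The $K$-curves are the curves along which $K$ is constant. Tangency to (the orthogonal trajectories of) a family of curves is required at every point $(u,v)\in U$: ${}^{(\alpha)}\bar T(u,v)$ (possibly zero) is tangent (respectively orthogonal) to the curve of the family through that point (for $K$-curves: at points where $dK\ne0$).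 *)

(* Defs.v *)
(* World: Stdlib reals, with Coquelicot. *)
From Stdlib Require Import Reals.
From Coquelicot Require Import Coquelicot.
Open Scope R_scope.

Definition vec : Type := (R * R * R)%type.
Definition cx (p : vec) : R := fst (fst p).
Definition cy (p : vec) : R := snd (fst p).
Definition cz (p : vec) : R := snd p.

Definition dot (p q : vec) : R := cx p * cx q + cy p * cy q + cz p * cz q.
Definition cross (p q : vec) : vec :=
  (cy p * cz q - cz p * cy q,
   cz p * cx q - cx p * cz q,
   cx p * cy q - cy p * cx q).
Definition det3 (p q r : vec) : R := dot p (cross q r).
Definition enorm (p : vec) : R := sqrt (dot p p).

Definition Dvec (c : R -> vec) (u : R) : vec :=
  (Derive (fun t => cx (c t)) u,
   Derive (fun t => cy (c t)) u,
   Derive (fun t => cz (c t)) u).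

Definition Rbar_interval (a b : Rbar) (u : R) : Prop :=
  Rbar_lt a u /\ Rbar_lt u b.

Definition class_C (n : nat) (I : R -> Prop) (f : R -> R) : Prop :=
  forall u, I u ->
    (forall k, (k <= n)%nat -> ex_derive_n f k u) /\
    continuous (Derive_n f n) u.

Definition class_C_vec (n : nat) (I : R -> Prop) (c : R -> vec) : Prop :=
  class_C n I (fun t => cx (c t)) /\
  class_C n I (fun t => cy (c t)) /\
  class_C n I (fun t => cz (c t)).

(* The two parameters u^1 = u and u^2 = v of a surface patch. *)
Inductive idx : Set := iu | iv.

Definition sum2 (f : idx -> R) : R := f iu + f iv.

Definition pd (i : idx) (f : R -> R -> R) (u v : R) : R :=
  match i with
  | iu => Derive (fun t => f t v) u
  | iv => Derive (fun t => f u t) v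
  end.

Definition pdvec (i : idx) (X : R -> R -> vec) (u v : R) : vec :=
  (pd i (fun a b => cx (X a b)) u v,
   pd i (fun a b => cy (X a b)) u v,
   pd i (fun a b => cz (X a b)) u v).

Definition mdet (m : idx -> idx -> R) : R := m iu iu * m iv iv - m iu iv * m iv iu.

Definition minv (m : idx -> idx -> R) (i j : idx) : R :=
  match i, j with
  | iu, iu => m iv iv / mdet m
  | iv, iv => m iu iu / mdet m
  | _, _ => - m i j / mdet m
  end.

Definition first_form (X : R -> R -> vec) (i j : idx) (u v : R) : R :=
  dot (pdvec i X u v) (pdvec j X u v).

Definition normal_dir (X : R -> R -> vec) (u v : R) : vec :=
  cross (pdvec iu X u v) (pdvec iv X u v).

Definition unit_normal (X : R -> R -> vec) (u v : R) : vec :=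
  scal (/ enorm (normal_dir X u v)) (normal_dir X u v).

Definition second_form (X : R -> R -> vec) (i j : idx) (u v : R) : R :=
  dot (unit_normal X u v) (pdvec i (pdvec j X) u v).

Definition gauss_curv (X : R -> R -> vec) (u v : R) : R :=
  mdet (fun i j => second_form X i j u v) / mdet (fun i j => first_form X i j u v).

Definition mean_curv (X : R -> R -> vec) (u v : R) : R :=
  / 2 * sum2 (fun i => sum2 (fun j =>
    minv (fun k l => first_form X k l u v) i j * second_form X i j u v)).

(* The relative geometry below depends on the relative normal field y only
   through its support function q = <unit_normal, y>. *)
Definition rel_metric (X : R -> R -> vec) (q : R -> R -> R) (i j : idx) (u v : R) : R :=
  / q u v * second_form X i j u v.

Definition rel_metric_inv (X : R -> R -> vec) (q : R -> R -> R) (i j : idx) (u v : R) : R :=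
  minv (fun k l => rel_metric X q k l u v) i j.

Definition darboux (X : R -> R -> vec) (q : R -> R -> R) (j k l : idx) (u v : R) : R :=
  / q u v * dot (unit_normal X u v) (pdvec j (pdvec k (pdvec l X)) u v)
  - / 2 * (pd l (rel_metric X q j k) u v
           + pd j (rel_metric X q k l) u v
           + pd k (rel_metric X q l j) u v).

Definition tcheb_cov (X : R -> R -> vec) (q : R -> R -> R) (i : idx) (u v : R) : R :=
  / 2 * sum2 (fun j => sum2 (fun k =>
    darboux X q i j k u v * rel_metric_inv X q j k u v)).

Definition tcheb (X : R -> R -> vec) (q : R -> R -> R) (i : idx) (u v : R) : R :=
  sum2 (fun j => rel_metric_inv X q i j u v * tcheb_cov X q j u v).

Definition support (X : R -> R -> vec) (alpha : R) (u v : R) : R :=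
  Rpower (Rabs (gauss_curv X u v)) alpha.

Definition tangent_vec (X : R -> R -> vec) (W : idx -> R -> R -> R) (u v : R) : vec :=
  plus (scal (W iu u v) (pdvec iu X u v)) (scal (W iv u v) (pdvec iv X u v)).

(* At every point of I x R where d phi <> 0, the vector W^i X_i (possibly zero)
   is orthogonal to the level curve of phi through that point, that is, to
   every a X_u + b X_v with d phi (a, b) = 0. *)
Definition orthogonal_to_level_curves (I : R -> Prop) (X : R -> R -> vec)
    (W : idx -> R -> R -> R) (phi : R -> R -> R) : Prop :=
  forall u v, I u ->
    (pd iu phi u v <> 0 \/ pd iv phi u v <> 0) ->
    forall a b, a * pd iu phi u v + b * pd iv phi u v = 0 ->
    dot (tangent_vec X W u v)
        (plus (scal a (pdvec iu X u v)) (scal b (pdvec iv X u v))) = 0.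

Definition max_principal_curv (X : R -> R -> vec) (u v : R) : R :=
  mean_curv X u v + sqrt (mean_curv X u v ^ 2 - gauss_curv X u v).

Definition min_principal_curv (X : R -> R -> vec) (u v : R) : R :=
  mean_curv X u v - sqrt (mean_curv X u v ^ 2 - gauss_curv X u v).

(* W^i X_i is everywhere a (possibly zero) principal vector for the principal
   curvature k. *)
Definition principal_for (I : R -> Prop) (X : R -> R -> vec)
    (W : idx -> R -> R -> R) (k : R -> R -> R) : Prop :=
  forall u v, I u -> forall i,
    sum2 (fun j => (second_form X i j u v - k u v * first_form X i j u v) * W j u v) = 0.

(* A surface with K < 0 has no umbilics, so its lines of curvature form exactly
   two families, one for each of the two principal curvature functions. *)
Definition tangent_to_family_of_curvature_lines (I : R -> Prop)
    (X : R -> R -> vec) (W : idx -> R -> R -> R) : Prop :=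
  principal_for I X W (max_principal_curv X) \/
  principal_for I X W (min_principal_curv X).

Definition ruled (s e : R -> vec) (u v : R) : vec := plus (s u) (scal v (e u)).

Definition param_distribution (s e : R -> vec) (u : R) : R :=
  det3 (Dvec s u) (e u) (Dvec e u).

(* Ruled C^3-surface over I x R free of torsal rulings, referred to its line of
   striction s and to the arc length of the spherical curve e. *)
Record skew_ruled_surface (I : R -> Prop) (s e : R -> vec) : Prop := {
  srs_C3_s : class_C_vec 3 I s;
  srs_C3_e : class_C_vec 3 I e;
  srs_unit : forall u, I u -> enorm (e u) = 1;
  srs_arclength : forall u, I u -> enorm (Dvec e u) = 1;
  srs_striction : forall u, I u -> dot (Dvec s u) (Dvec e u) = 0;
  srs_immersion : forall u v, I u -> normal_dir (ruled s e) u v <> zero;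
  srs_injective : forall u v u' v', I u -> I u' ->
    ruled s e u v = ruled s e u' v' -> u = u' /\ v = v';
  srs_nontorsal : forall u, I u -> param_distribution s e u <> 0
}.

(* (A, B, L, c) stands for the quadric with equation
   A_x x^2 + A_y y^2 + A_z z^2 + B_x y z + B_y x z + B_z x y + <L, (x,y,z)> + c = 0;
   as a product of copies of R it carries Coquelicot's uniform structure. *)
Definition quadric : Type := (vec * vec * vec * R)%type.

Definition quadric_eval (Q : quadric) (p : vec) : R :=
  let '(A, B, L, c) := Q in
  cx A * cx p ^ 2 + cy A * cy p ^ 2 + cz A * cz p ^ 2
  + cx B * (cy p * cz p) + cy B * (cx p * cz p) + cz B * (cx p * cy p)
  + dot L p + c.

Definition contains_ruling (Q : quadric) (s e : R -> vec) (u : R) : Prop :=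
  forall v, quadric_eval Q (ruled s e u v) = 0.

(* Q is the limit of the quadrics through three distinct rulings u1, u2, u3 as
   these tend to u.  Quadrics are determined up to a nonzero factor, hence the
   limit is taken in projective space: some multiple Q' of the coefficients is
   close to Q.  On a skew surface the rulings near u are pairwise skew and the
   quadric through three of them is unique. *)
Definition osculating_quadric (I : R -> Prop) (s e : R -> vec) (u : R)
    (Q : quadric) : Prop :=
  Q <> zero /\
  forall eps : posreal, exists d : posreal,
    forall u1 u2 u3, I u1 -> I u2 -> I u3 ->
      ball u d u1 -> ball u d u2 -> ball u d u3 ->
      u1 <> u2 -> u2 <> u3 -> u1 <> u3 ->
      exists Q' : quadric,
        Q' <> zero /\
        contains_ruling Q' s e u1 /\
        contains_ruling Q' s e u2 /\
        contains_ruling Q' s e u3 /\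
        ball Q eps Q'.

(* Centre c, unit axis direction a, radius r of the gorge circle.  Only the
   one-sheeted hyperboloid is needed: the two-sheeted one contains no line. *)
Definition rotational_hyperboloid (Q : quadric) : Prop :=
  exists (c a : vec) (r k mu : R),
    enorm a = 1 /\ 0 < r /\ 0 < k /\ mu <> 0 /\
    forall p : vec,
      let w := minus p c in
      quadric_eval Q p =
      mu * ((dot w w - dot w a ^ 2) / r ^ 2 - dot w a ^ 2 / k ^ 2 - 1).

Definition edlinger (I : R -> Prop) (s e : R -> vec) : Prop :=
  forall u, I u ->
    exists Q : quadric, osculating_quadric I s e u Q /\ rotational_hyperboloid Q.

(* Main.v *)
Require Import Defs.
From Stdlib Require Import Reals Lra.
From Coquelicot Require Import Coquelicot.
Open Scope R_scope.

(** Write d for the parameter of distribution, k for the conical curvature and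
    a = <s', e> for the component of s' along the ruling (that is, d times
    lambda), and let L be the logarithm of |K|.

    The hypotheses on the Tchebychev vector become equations between
    invariants because, for every support function q, the Tchebychev covector
    is the differential of ln (q / |K|^(1/4)) ([tcheb_cov_ruled]).  For
    q = |K|^alpha it is therefore (alpha - 1/4) dL ([tcheb_cov_support]), and
    the factor does not vanish.  As the relative metric is conformal to the
    second fundamental form h, this says that h maps T to q (alpha - 1/4) dL
    ([second_form_tcheb]).  If T is a principal vector, h also maps T to a
    multiple of its metric dual; that multiple is nonzero where dL is, hence T
    is orthogonal to the K-curves ([K_curves_of_principal]).  So only the two
    orthogonality conditions remain.  Along each ruling they are polynomial
    equations in v, and their coefficients force d' = 0 and d + k a = 0, which
    is 1 + kappa lambda = 0
    ([invariants_of_striction_distance], [invariants_of_K_curves]).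

    It remains to see that these two equations make the osculating quadrics
    rotational hyperboloids ([edlinger_of_invariants]).  A line with direction
    e through the point s has the Pluecker coordinates (e, m), m = s x e, and
    p x e - m is a normal of the plane joining it to p.  A point lies on the
    quadric through three skew lines exactly when these three planes share a
    line, so det (p x e1 - m1, p x e2 - m2, p x e3 - m3) = 0 is an equation of
    the quadric; its cubic terms cancel.  The determinant is trilinear and
    alternating in the lines, so the three rulings may be replaced by their
    divided differences of order 0, 1 and 2.  These converge when the rulings
    coalesce, and the limit is the same determinant formed with (e, m),
    (e', m') and (e'', m'') / 2 ([osculating_quadric_of_tangents]).  In the
    coordinates (x, y, z) of the striction frame it is
      -(a + d k) z^2 + 2 d x z - d k y^2 - d' y z - 2 d^2 y = 0
    ([osculating_form]), and for d' = 0, a = - d / k this is a hyperboloid of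
    revolution. *)

(** * Vector algebra *)

Lemma vec_ext (p q : vec) : cx p = cx q -> cy p = cy q -> cz p = cz q -> p = q.
Proof.
  destruct p as [[p1 p2] p3], q as [[q1 q2] q3]; unfold cx, cy, cz; simpl.
  now intros -> -> ->.
Qed.

Lemma vec_components (p : vec) : p = (cx p, cy p, cz p).
Proof. now destruct p as [[p1 p2] p3]. Qed.

Ltac vec_expand :=
  unfold det3, dot, cross, cx, cy, cz, minus, plus, opp, scal, zero in *; simpl;
  unfold prod_plus, prod_opp, prod_scal, prod_zero, mult, plus, opp, scal, zero in *; simpl;
  unfold mult in *; simpl.

Ltac vec_ring :=
  repeat match goal with p : vec |- _ => destruct p as [[? ?] ?] end;
  try apply vec_ext; vec_expand; ring.

Lemma dot_comm (p q : vec) : dot p q = dot q p.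
Proof. vec_ring. Qed.

Lemma dot_plus_l (p q r : vec) : dot (plus p q) r = dot p r + dot q r.
Proof. vec_ring. Qed.

Lemma dot_scal_l (k : R) (p r : vec) : dot (scal k p) r = k * dot p r.
Proof. vec_ring. Qed.

Lemma dot_minus_l (p q r : vec) : dot (minus p q) r = dot p r - dot q r.
Proof. vec_ring. Qed.

Lemma det3_cyclic (p q r : vec) : det3 p q r = det3 q r p.
Proof. vec_ring. Qed.

(** Multiplicativity of the determinant, for the product of one matrix and the
    transpose of the other. *)
Lemma det3_gram (p q r f g h : vec) :
  det3 p q r * det3 f g h =
  det3 (dot p f, dot p g, dot p h) (dot q f, dot q g, dot q h) (dot r f, dot r g, dot r h).
Proof. vec_ring. Qed.

Lemma enorm_one (p : vec) : enorm p = 1 -> dot p p = 1.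
Proof.
  unfold enorm; intros Hp.
  destruct (Rle_dec 0 (dot p p)) as [Hpos | Hneg].
  - rewrite <- (sqrt_sqrt _ Hpos), Hp; ring.
  - rewrite sqrt_neg_0 in Hp by lra; lra.
Qed.

Lemma one_enorm (p : vec) : dot p p = 1 -> enorm p = 1.
Proof. unfold enorm; intros ->; apply sqrt_1. Qed.

(** * Orthonormal frames *)

Definition orthonormal (e n : vec) : Prop := dot e e = 1 /\ dot n n = 1 /\ dot e n = 0.

Lemma orthonormal_third (e n : vec) :
  orthonormal e n ->
  dot (cross e n) (cross e n) = 1 /\ dot e (cross e n) = 0 /\ dot n (cross e n) = 0.
Proof.
  intros (He & Hn & Hen); repeat split; [| vec_ring | vec_ring].
  transitivity (dot e e * dot n n - dot e n ^ 2); [vec_ring | rewrite He, Hn, Hen; ring].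
Qed.

Lemma orthonormal_det (e n : vec) : orthonormal e n -> det3 e n (cross e n) = 1.
Proof.
  intros (He & Hn & Hen).
  transitivity (dot e e * dot n n - dot e n ^ 2); [vec_ring | rewrite He, Hn, Hen; ring].
Qed.

Lemma det3_frame (e n p q r : vec) :
  orthonormal e n ->
  det3 p q r = det3 (dot p e, dot p n, dot p (cross e n))
                    (dot q e, dot q n, dot q (cross e n))
                    (dot r e, dot r n, dot r (cross e n)).
Proof.
  intros Hf; rewrite <- det3_gram, (orthonormal_det _ _ Hf); ring.
Qed.

(** The coefficients come from Cramer's rule, since the frame has determinant 1. *)
Lemma frame_expansion (e n p : vec) :
  orthonormal e n ->
  p = plus (plus (scal (dot p e) e) (scal (dot p n) n)) (scal (dot p (cross e n)) (cross e n)).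
Proof.
  intros Hf; pose proof (orthonormal_det _ _ Hf) as Hd; destruct Hf as (He & Hn & Hen).
  transitivity (plus (plus (scal (det3 p n (cross e n)) e) (scal (det3 e p (cross e n)) n))
                     (scal (dot p (cross e n)) (cross e n))).
  - transitivity (scal (det3 e n (cross e n)) p); [| vec_ring].
    rewrite Hd; vec_ring.
  - replace (det3 p n (cross e n)) with (dot p e * dot n n - dot p n * dot e n) by vec_ring.
    replace (det3 e p (cross e n)) with (dot p n * dot e e - dot p e * dot e n) by vec_ring.
    rewrite He, Hn, Hen; f_equal; f_equal; f_equal; ring.
Qed.

Lemma parseval (e n p q : vec) :
  orthonormal e n ->
  dot p q = dot p e * dot q e + dot p n * dot q n + dot p (cross e n) * dot q (cross e n).
Proof.
  intros Hf; rewrite (frame_expansion e n p Hf) at 1.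
  rewrite !dot_plus_l, !dot_scal_l, (dot_comm e), (dot_comm n), (dot_comm (cross e n)); ring.
Qed.

(** * The quadric through three lines *)

(** Each argument of the determinant is a normal of the plane joining [p] to one
    of the lines, given by direction and moment. *)
Definition three_line_form (e1 m1 e2 m2 e3 m3 p : vec) : R :=
  det3 (minus (cross p e1) m1) (minus (cross p e2) m2) (minus (cross p e3) m3).

Definition square_part (d m : vec) : vec := (cx d * cx m, cy d * cy m, cz d * cz m).
Definition mixed_part (d m : vec) : vec :=
  (cy d * cz m + cz d * cy m, cx d * cz m + cz d * cx m, cx d * cy m + cy d * cx m).

(** The coefficients of [three_line_form] as a polynomial in [p].  The cubic part
    det (p x e1, p x e2, p x e3) vanishes because its three columns are
    orthogonal to [p]; the quadratic part follows from
    (p x a) x (p x b) = (p . (a x b)) p. *)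
Definition line_quadric (e1 m1 e2 m2 e3 m3 : vec) : quadric :=
  (opp (plus (plus (square_part (cross e1 e2) m3) (square_part (cross e2 e3) m1))
             (square_part (cross e3 e1) m2)),
   opp (plus (plus (mixed_part (cross e1 e2) m3) (mixed_part (cross e2 e3) m1))
             (mixed_part (cross e3 e1) m2)),
   plus (plus (cross e1 (cross m2 m3)) (cross e2 (cross m3 m1))) (cross e3 (cross m1 m2)),
   - det3 m1 m2 m3).

Lemma line_quadric_eval (e1 m1 e2 m2 e3 m3 p : vec) :
  quadric_eval (line_quadric e1 m1 e2 m2 e3 m3) p = three_line_form e1 m1 e2 m2 e3 m3 p.
Proof.
  unfold line_quadric, quadric_eval, three_line_form, square_part, mixed_part; vec_ring.
Qed.

Lemma quadric_eval_nonzero (Q : quadric) (p : vec) : quadric_eval Q p <> 0 -> Q <> zero.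
Proof.
  intros Hp ->; apply Hp; unfold quadric_eval; simpl.
  unfold prod_zero; simpl; vec_ring.
Qed.

(** * Divided differences at coalescing nodes *)

Definition slope (f : R -> R) (x y : R) : R := (f y - f x) / (y - x).
Definition second_difference (f : R -> R) (x y z : R) : R :=
  (slope f x z - slope f x y) / (z - y).

Lemma slope_mean_value (f f1 : R -> R) (x y : R) :
  x <> y ->
  (forall t, Rmin x y <= t <= Rmax x y -> is_derive f t (f1 t)) ->
  exists c, Rmin x y <= c <= Rmax x y /\ slope f x y = f1 c.
Proof.
  intros Hxy Hf.
  destruct (MVT_gen f x y f1) as (c & Hc & Heq).
  - intros t Ht; apply Hf; lra.
  - intros t Ht; apply continuity_pt_filterlim, (ex_derive_continuous f).
    now exists (f1 t); apply Hf.
  - exists c; split; [exact Hc |].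
    unfold slope; rewrite Heq; field; lra.
Qed.

Lemma second_difference_swap_12 (f : R -> R) (x y z : R) :
  x <> y -> y <> z -> x <> z -> second_difference f x y z = second_difference f y x z.
Proof. intros; unfold second_difference, slope; field; repeat split; lra. Qed.

Lemma second_difference_swap_23 (f : R -> R) (x y z : R) :
  x <> y -> y <> z -> x <> z -> second_difference f x y z = second_difference f x z y.
Proof. intros; unfold second_difference, slope; field; repeat split; lra. Qed.

(** By symmetry the nodes may be sorted.  The slopes over the two adjacent
    intervals are values of the derivative at points no farther apart than the
    outer nodes, so a second application of the mean value theorem gives the
    bound. *)
Lemma second_difference_bound (f f1 f2 : R -> R) (J : R -> Prop) (M x y z : R) :
  (forall t t' r, J t -> J t' -> t <= r <= t' -> J r) ->
  (forall t, J t -> is_derive f t (f1 t) /\ is_derive f1 t (f2 t) /\ Rabs (f2 t) <= M) ->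
  J x -> J y -> J z -> x <> y -> y <> z -> x <> z ->
  Rabs (second_difference f x y z) <= M.
Proof.
  intros HJ Hf.
  assert (sorted : forall a b c, J a -> J b -> J c -> a < b -> b < c ->
                     Rabs (second_difference f a b c) <= M).
  { intros a b c Ja Jb Jc Hab Hbc.
    assert (Hin : forall t, a <= t <= c -> J t) by (intros t Ht; now apply (HJ a c)).
    destruct (slope_mean_value f f1 a b) as (p & Hp & Hsp);
      [lra | rewrite Rmin_left, Rmax_right by lra; intros t Ht; apply Hf, Hin; lra |].
    destruct (slope_mean_value f f1 b c) as (q & Hq & Hsq);
      [lra | rewrite Rmin_left, Rmax_right by lra; intros t Ht; apply Hf, Hin; lra |].
    rewrite Rmin_left, Rmax_right in Hp by lra; rewrite Rmin_left, Rmax_right in Hq by lra.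
    assert (Hdd : second_difference f a b c = (f1 q - f1 p) / (c - a)).
    { rewrite <- Hsp, <- Hsq; unfold second_difference, slope; field; repeat split; lra. }
    destruct (MVT_gen f1 p q f2) as (r & Hr & Heq).
    - rewrite Rmin_left, Rmax_right by lra; intros t Ht; apply Hf, Hin; lra.
    - rewrite Rmin_left, Rmax_right by lra; intros t Ht.
      apply continuity_pt_filterlim, (ex_derive_continuous f1).
      exists (f2 t); apply Hf, Hin; lra.
    - rewrite Rmin_left, Rmax_right in Hr by lra.
      assert (HM : Rabs (f2 r) <= M) by (apply Hf, Hin; lra).
      rewrite Hdd, Heq; unfold Rdiv; rewrite !Rabs_mult, Rabs_inv.
      rewrite (Rabs_right (q - p)), (Rabs_right (c - a)) by lra.
      apply Rmult_le_reg_r with (c - a); [lra |].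
      replace (Rabs (f2 r) * (q - p) * / (c - a) * (c - a)) with (Rabs (f2 r) * (q - p))
        by (field; lra).
      apply Rmult_le_compat; try lra; apply Rabs_pos. }
  intros Jx Jy Jz Hxy Hyz Hxz.
  destruct (Rlt_dec x y), (Rlt_dec y z), (Rlt_dec x z); try lra.
  - now apply sorted.
  - rewrite second_difference_swap_23 by auto; apply sorted; auto; lra.
  - rewrite second_difference_swap_23, second_difference_swap_12 by auto.
    apply sorted; auto; lra.
  - rewrite second_difference_swap_12 by auto; apply sorted; auto; lra.
  - rewrite second_difference_swap_12, second_difference_swap_23 by auto.
    apply sorted; auto; lra.
  - rewrite second_difference_swap_12, second_difference_swap_23, second_difference_swap_12
      by auto.
    apply sorted; auto; lra.
Qed.

(** The filter of triples of distinct nodes tending to [u]: this is the limit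
    process in the definition of the osculating quadric. *)
Definition coalescing (u : R) : (R * R * R -> Prop) -> Prop :=
  within (fun t => fst (fst t) <> snd (fst t) /\ snd (fst t) <> snd t /\ fst (fst t) <> snd t)
    (locally (u, u, u)).

Lemma coalescing_intro (u : R) (P : R * R * R -> Prop) (d : posreal) :
  (forall x y z, Rabs (x - u) < d -> Rabs (y - u) < d -> Rabs (z - u) < d ->
     x <> y -> y <> z -> x <> z -> P (x, y, z)) ->
  coalescing u P.
Proof.
  intros HP; exists d; intros [[x y] z] [[Hx Hy] Hz] (Hxy & Hyz & Hxz); now apply HP.
Qed.

Lemma coalescing_elim (u : R) (P : R * R * R -> Prop) :
  coalescing u P ->
  exists d : posreal, forall x y z, ball u d x -> ball u d y -> ball u d z ->
    x <> y -> y <> z -> x <> z -> P (x, y, z).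
Proof.
  intros [d Hd]; exists d; intros x y z Hx Hy Hz Hxy Hyz Hxz.
  apply (Hd (x, y, z)); repeat split; auto.
Qed.

Global Instance coalescing_filter (u : R) : Filter (coalescing u).
Proof. apply within_filter, locally_filter. Qed.

Definition twice_differentiable (f f1 f2 : R -> R) (u : R) : Prop :=
  locally u (fun t => is_derive f t (f1 t) /\ is_derive f1 t (f2 t)) /\ continuous f2 u.

Lemma first_node_limit (f f1 f2 : R -> R) (u : R) :
  twice_differentiable f f1 f2 u ->
  filterlim (fun t => f (fst (fst t))) (coalescing u) (locally (f u)).
Proof.
  intros [Hd _].
  assert (Hc : continuous f u).
  { apply (ex_derive_continuous f); exists (f1 u).
    now destruct (locally_singleton _ _ Hd). }
  intros P HP; destruct (Hc P HP) as [d Hdl].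
  apply (coalescing_intro u _ d); intros x y z Hx _ _ _ _ _; now apply Hdl.
Qed.

Lemma slope_limit (f f1 f2 : R -> R) (u : R) :
  twice_differentiable f f1 f2 u ->
  filterlim (fun t => slope f (fst (fst t)) (snd (fst t))) (coalescing u) (locally (f1 u)).
Proof.
  intros [Hd _].
  assert (Hc : continuous f1 u).
  { apply (ex_derive_continuous f1); exists (f2 u).
    now destruct (locally_singleton _ _ Hd). }
  intros P HP.
  destruct (filter_and _ _ Hd (Hc P HP)) as [d Hdl].
  apply (coalescing_intro u _ d); intros x y z Hx Hy _ Hxy _ _; simpl.
  assert (Hin : forall t, Rmin x y <= t <= Rmax x y -> Rabs (t - u) < d).
  { intros t Ht; apply Rabs_def2 in Hx, Hy.
    destruct (Rle_dec x y);
      [rewrite Rmin_left, Rmax_right in Ht by lra | rewrite Rmin_right, Rmax_left in Ht by lra];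
      apply Rabs_def1; lra. }
  destruct (slope_mean_value f f1 x y Hxy) as (c & Hcc & ->).
  - intros t Ht; now apply (Hdl t (Hin t Ht)).
  - now apply (Hdl c (Hin c Hcc)).
Qed.

(** Subtracting the parabola with the second derivative of [f] at [u] leaves a
    function whose second derivative is small near [u], to which
    [second_difference_bound] applies. *)
Lemma second_difference_limit (f f1 f2 : R -> R) (u : R) :
  twice_differentiable f f1 f2 u ->
  filterlim (fun t => second_difference f (fst (fst t)) (snd (fst t)) (snd t))
    (coalescing u) (locally (f2 u / 2)).
Proof.
  intros [Hd Hc]; apply filterlim_locally; intros eps.
  assert (He : 0 < eps / 2) by (destruct eps; simpl; lra).
  pose proof (proj1 (filterlim_locally f2 (f2 u)) Hc (mkposreal _ He)) as Hball.
  destruct (filter_and _ _ Hd Hball) as [d Hdl].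
  apply (coalescing_intro u _ d); intros x y z Hx Hy Hz Hxy Hyz Hxz; simpl.
  (* The second difference of t^2 is 1, hence the coefficient f2 u / 2. *)
  set (g := fun t => f t - f2 u / 2 * t ^ 2).
  assert (Hg : second_difference f x y z - f2 u / 2 = second_difference g x y z).
  { unfold second_difference, slope, g; field; repeat split; lra. }
  change (Rabs (second_difference f x y z - f2 u / 2) < eps); rewrite Hg.
  apply Rle_lt_trans with (eps / 2); [| lra].
  apply (second_difference_bound g (fun t => f1 t - f2 u * t) (fun t => f2 t - f2 u)
           (fun t => Rabs (t - u) < d)); auto.
  - intros t t' r Ht Ht' Hr; apply Rabs_def2 in Ht, Ht'; apply Rabs_def1; lra.
  - intros t Ht; destruct (Hdl t Ht) as [[H1 H2] H3]; split; [| split].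
    + unfold g; apply (is_derive_minus f (fun t => f2 u / 2 * t ^ 2) t (f1 t) (f2 u * t));
        [exact H1 | auto_derive; [trivial | field]].
    + apply (is_derive_minus f1 (fun t => f2 u * t) t (f2 t) (f2 u));
        [exact H2 | auto_derive; [trivial | field]].
    + apply Rlt_le, H3.
Qed.

(** * Limits of vector-valued maps *)

Lemma lim_pair {T : Type} {U V : UniformSpace} {F : (T -> Prop) -> Prop} {FF : Filter F}
    (f : T -> U) (g : T -> V) (x : U) (y : V) :
  filterlim f F (locally x) -> filterlim g F (locally y) ->
  filterlim (fun t => (f t, g t)) F (locally (x, y)).
Proof.
  intros Hf Hg; apply filterlim_locally; intros eps.
  pose proof (proj1 (filterlim_locally f x) Hf eps) as Hf'.
  pose proof (proj1 (filterlim_locally g y) Hg eps) as Hg'.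
  generalize (filter_and _ _ Hf' Hg'); apply filter_imp; intros t [H1 H2]; now split.
Qed.

Lemma lim_plus {T : Type} {F : (T -> Prop) -> Prop} {FF : Filter F} (f g : T -> R) (x y : R) :
  filterlim f F (locally x) -> filterlim g F (locally y) ->
  filterlim (fun t => f t + g t) F (locally (x + y)).
Proof. intros Hf Hg; exact (filterlim_comp_2 f g Rplus Hf Hg (filterlim_plus x y)). Qed.

Lemma lim_mult {T : Type} {F : (T -> Prop) -> Prop} {FF : Filter F} (f g : T -> R) (x y : R) :
  filterlim f F (locally x) -> filterlim g F (locally y) ->
  filterlim (fun t => f t * g t) F (locally (x * y)).
Proof. intros Hf Hg; exact (filterlim_comp_2 f g Rmult Hf Hg (filterlim_mult x y)). Qed.

Lemma lim_opp {T : Type} {F : (T -> Prop) -> Prop} {FF : Filter F} (f : T -> R) (x : R) :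
  filterlim f F (locally x) -> filterlim (fun t => - f t) F (locally (- x)).
Proof. intros Hf; exact (filterlim_comp _ _ _ f Ropp _ _ _ Hf (filterlim_opp x)). Qed.

(** Componentwise convergence, in which the polynomial operations on vectors are
    handled one real limit at a time. *)
Definition vlim {T : Type} (F : (T -> Prop) -> Prop) (f : T -> vec) (p : vec) : Prop :=
  filterlim (fun t => cx (f t)) F (locally (cx p)) /\
  filterlim (fun t => cy (f t)) F (locally (cy p)) /\
  filterlim (fun t => cz (f t)) F (locally (cz p)).

Ltac lim_step :=
  match goal with
  | H : filterlim ?f ?F _ |- filterlim ?f ?F _ => exact H
  | |- filterlim (fun t => @?f t + @?g t) _ _ => apply (lim_plus f g)
  | |- filterlim (fun t => @?f t - @?g t) _ _ => apply (lim_plus f (fun t => - g t))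
  | |- filterlim (fun t => @?f t * @?g t) _ _ => apply (lim_mult f g)
  | |- filterlim (fun t => - @?f t) _ _ => apply (lim_opp f)
  end.

Ltac lim_components :=
  unfold vlim, det3, dot, cross, square_part, mixed_part, cx, cy, cz in *; simpl fst in *; simpl snd in *;
  repeat match goal with H : _ /\ _ |- _ => destruct H end;
  repeat split; repeat lim_step.

Lemma vlim_locally {T : Type} {F : (T -> Prop) -> Prop} {FF : Filter F} (f : T -> vec) (p : vec) :
  vlim F f p -> filterlim f F (locally p).
Proof.
  intros (Hx & Hy & Hz); rewrite (vec_components p).
  apply (filterlim_ext (fun t => (cx (f t), cy (f t), cz (f t)))).
  - intros t; symmetry; apply vec_components.
  - now apply (lim_pair (fun t => (cx (f t), cy (f t)))); [apply lim_pair |].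
Qed.

Lemma vlim_plus {T : Type} {F : (T -> Prop) -> Prop} {FF : Filter F} (f g : T -> vec) (p q : vec) :
  vlim F f p -> vlim F g q -> vlim F (fun t => plus (f t) (g t)) (plus p q).
Proof.
  intros (Hfx & Hfy & Hfz) (Hgx & Hgy & Hgz).
  exact (conj (lim_plus _ _ _ _ Hfx Hgx)
           (conj (lim_plus _ _ _ _ Hfy Hgy) (lim_plus _ _ _ _ Hfz Hgz))).
Qed.

Lemma vlim_opp {T : Type} {F : (T -> Prop) -> Prop} {FF : Filter F} (f : T -> vec) (p : vec) :
  vlim F f p -> vlim F (fun t => opp (f t)) (opp p).
Proof.
  intros (Hfx & Hfy & Hfz).
  exact (conj (lim_opp _ _ Hfx) (conj (lim_opp _ _ Hfy) (lim_opp _ _ Hfz))).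
Qed.

Lemma vlim_cross {T : Type} {F : (T -> Prop) -> Prop} {FF : Filter F} (f g : T -> vec) (p q : vec) :
  vlim F f p -> vlim F g q -> vlim F (fun t => cross (f t) (g t)) (cross p q).
Proof. intros Hf Hg; lim_components. Qed.

Lemma vlim_square_part {T : Type} {F : (T -> Prop) -> Prop} {FF : Filter F}
    (f g : T -> vec) (p q : vec) :
  vlim F f p -> vlim F g q -> vlim F (fun t => square_part (f t) (g t)) (square_part p q).
Proof. intros Hf Hg; lim_components. Qed.

Lemma vlim_mixed_part {T : Type} {F : (T -> Prop) -> Prop} {FF : Filter F}
    (f g : T -> vec) (p q : vec) :
  vlim F f p -> vlim F g q -> vlim F (fun t => mixed_part (f t) (g t)) (mixed_part p q).
Proof. intros Hf Hg; lim_components. Qed.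

Lemma lim_det3 {T : Type} {F : (T -> Prop) -> Prop} {FF : Filter F}
    (f g h : T -> vec) (p q r : vec) :
  vlim F f p -> vlim F g q -> vlim F h r ->
  filterlim (fun t => det3 (f t) (g t) (h t)) F (locally (det3 p q r)).
Proof. intros Hf Hg Hh; lim_components. Qed.

Lemma lim_quadric {T : Type} {F : (T -> Prop) -> Prop} {FF : Filter F}
    (A B L : T -> vec) (c : T -> R) (A0 B0 L0 : vec) (c0 : R) :
  filterlim A F (locally A0) -> filterlim B F (locally B0) -> filterlim L F (locally L0) ->
  filterlim c F (locally c0) ->
  filterlim (fun t => (A t, B t, L t, c t) : quadric) F (locally ((A0, B0, L0, c0) : quadric)).
Proof.
  intros HA HB HL Hc.
  exact (lim_pair (fun t => (A t, B t, L t)) c (A0, B0, L0) c0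
           (lim_pair (fun t => (A t, B t)) L (A0, B0) L0 (lim_pair A B A0 B0 HA HB) HL) Hc).
Qed.

Lemma line_quadric_limit {T : Type} {F : (T -> Prop) -> Prop} {FF : Filter F}
    (e1 m1 e2 m2 e3 m3 : T -> vec) (p1 q1 p2 q2 p3 q3 : vec) :
  vlim F e1 p1 -> vlim F m1 q1 -> vlim F e2 p2 -> vlim F m2 q2 -> vlim F e3 p3 -> vlim F m3 q3 ->
  filterlim (fun t => line_quadric (e1 t) (m1 t) (e2 t) (m2 t) (e3 t) (m3 t)) F
    (locally (line_quadric p1 q1 p2 q2 p3 q3)).
Proof.
  intros H1 K1 H2 K2 H3 K3.
  pose proof (vlim_cross _ _ _ _ H1 H2) as H12.
  pose proof (vlim_cross _ _ _ _ H2 H3) as H23.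
  pose proof (vlim_cross _ _ _ _ H3 H1) as H31.
  apply lim_quadric.
  - apply (vlim_locally _ _ (vlim_opp _ _ (vlim_plus _ _ _ _
      (vlim_plus _ _ _ _ (vlim_square_part _ _ _ _ H12 K3) (vlim_square_part _ _ _ _ H23 K1))
      (vlim_square_part _ _ _ _ H31 K2)))).
  - apply (vlim_locally _ _ (vlim_opp _ _ (vlim_plus _ _ _ _
      (vlim_plus _ _ _ _ (vlim_mixed_part _ _ _ _ H12 K3) (vlim_mixed_part _ _ _ _ H23 K1))
      (vlim_mixed_part _ _ _ _ H31 K2)))).
  - apply (vlim_locally _ _ (vlim_plus _ _ _ _
      (vlim_plus _ _ _ _ (vlim_cross _ _ _ _ H1 (vlim_cross _ _ _ _ K2 K3))
         (vlim_cross _ _ _ _ H2 (vlim_cross _ _ _ _ K3 K1)))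
      (vlim_cross _ _ _ _ H3 (vlim_cross _ _ _ _ K1 K2)))).
  - exact (lim_opp _ _ (lim_det3 _ _ _ _ _ _ K1 K2 K3)).
Qed.

Lemma line_quadric_eval_limit {T : Type} {F : (T -> Prop) -> Prop} {FF : Filter F}
    (e1 m1 e2 m2 e3 m3 : T -> vec) (p1 q1 p2 q2 p3 q3 p : vec) :
  vlim F e1 p1 -> vlim F m1 q1 -> vlim F e2 p2 -> vlim F m2 q2 -> vlim F e3 p3 -> vlim F m3 q3 ->
  filterlim (fun t => quadric_eval (line_quadric (e1 t) (m1 t) (e2 t) (m2 t) (e3 t) (m3 t)) p) F
    (locally (quadric_eval (line_quadric p1 q1 p2 q2 p3 q3) p)).
Proof.
  intros H1 K1 H2 K2 H3 K3; rewrite line_quadric_eval.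
  apply (filterlim_ext
    (fun t => three_line_form (e1 t) (m1 t) (e2 t) (m2 t) (e3 t) (m3 t) p)).
  { intros t; symmetry; apply line_quadric_eval. }
  assert (Hp : vlim F (fun _ => p) p) by (repeat split; apply filterlim_const).
  exact (lim_det3 _ _ _ _ _ _
    (vlim_plus _ _ _ _ (vlim_cross _ _ _ _ Hp H1) (vlim_opp _ _ K1))
    (vlim_plus _ _ _ _ (vlim_cross _ _ _ _ Hp H2) (vlim_opp _ _ K2))
    (vlim_plus _ _ _ _ (vlim_cross _ _ _ _ Hp H3) (vlim_opp _ _ K3))).
Qed.

(** * Differentiation of vector functions *)

(** [Dvec] is total; this relation also asserts differentiability. *)
Definition is_dvec (c : R -> vec) (u : R) (d : vec) : Prop :=
  is_derive (fun t => cx (c t)) u (cx d) /\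
  is_derive (fun t => cy (c t)) u (cy d) /\
  is_derive (fun t => cz (c t)) u (cz d).

Lemma der_plus (f g : R -> R) (u df dg : R) :
  is_derive f u df -> is_derive g u dg -> is_derive (fun t => f t + g t) u (df + dg).
Proof. intros Hf Hg; exact (is_derive_plus f g u df dg Hf Hg). Qed.

Lemma der_minus (f g : R -> R) (u df dg : R) :
  is_derive f u df -> is_derive g u dg -> is_derive (fun t => f t - g t) u (df - dg).
Proof. intros Hf Hg; exact (is_derive_minus f g u df dg Hf Hg). Qed.

Lemma der_mult (f g : R -> R) (u df dg : R) :
  is_derive f u df -> is_derive g u dg ->
  is_derive (fun t => f t * g t) u (df * g u + f u * dg).
Proof. intros Hf Hg; exact (is_derive_mult f g u df dg Hf Hg Rmult_comm). Qed.

Lemma is_dvec_eq (c : R -> vec) (u : R) (d d' : vec) : is_dvec c u d -> d = d' -> is_dvec c u d'.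
Proof. now intros H <-. Qed.

Lemma is_dvec_unique (c : R -> vec) (u : R) (d : vec) : is_dvec c u d -> Dvec c u = d.
Proof.
  intros (Hx & Hy & Hz); apply vec_ext.
  - exact (is_derive_unique _ _ _ Hx).
  - exact (is_derive_unique _ _ _ Hy).
  - exact (is_derive_unique _ _ _ Hz).
Qed.

Lemma is_dvec_ext_loc (c c' : R -> vec) (u : R) (d : vec) :
  locally u (fun t => c t = c' t) -> is_dvec c u d -> is_dvec c' u d.
Proof.
  intros Heq (Hx & Hy & Hz); split; [| split].
  - apply (is_derive_ext_loc (fun t => cx (c t))); [| exact Hx].
    revert Heq; apply filter_imp; now intros t ->.
  - apply (is_derive_ext_loc (fun t => cy (c t))); [| exact Hy].
    revert Heq; apply filter_imp; now intros t ->.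
  - apply (is_derive_ext_loc (fun t => cz (c t))); [| exact Hz].
    revert Heq; apply filter_imp; now intros t ->.
Qed.

Lemma is_dvec_const (p : vec) (u : R) : is_dvec (fun _ => p) u zero.
Proof.
  exact (conj (is_derive_const (cx p) u)
           (conj (is_derive_const (cy p) u) (is_derive_const (cz p) u))).
Qed.

Lemma is_dvec_plus (c d : R -> vec) (u : R) (c' d' : vec) :
  is_dvec c u c' -> is_dvec d u d' -> is_dvec (fun t => plus (c t) (d t)) u (plus c' d').
Proof.
  intros (Hcx & Hcy & Hcz) (Hdx & Hdy & Hdz).
  exact (conj (der_plus _ _ _ _ _ Hcx Hdx)
           (conj (der_plus _ _ _ _ _ Hcy Hdy) (der_plus _ _ _ _ _ Hcz Hdz))).
Qed.

Lemma is_dvec_scal (k : R -> R) (c : R -> vec) (u k' : R) (c' : vec) :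
  is_derive k u k' -> is_dvec c u c' ->
  is_dvec (fun t => scal (k t) (c t)) u (plus (scal k' (c u)) (scal (k u) c')).
Proof.
  intros Hk (Hcx & Hcy & Hcz).
  exact (conj (der_mult _ _ _ _ _ Hk Hcx)
           (conj (der_mult _ _ _ _ _ Hk Hcy) (der_mult _ _ _ _ _ Hk Hcz))).
Qed.

Lemma is_derive_eq (f : R -> R) (u d d' : R) : is_derive f u d -> d = d' -> is_derive f u d'.
Proof. now intros H <-. Qed.

Lemma is_derive_dot (c d : R -> vec) (u : R) (c' d' : vec) :
  is_dvec c u c' -> is_dvec d u d' ->
  is_derive (fun t => dot (c t) (d t)) u (dot c' (d u) + dot (c u) d').
Proof.
  intros (Hcx & Hcy & Hcz) (Hdx & Hdy & Hdz).
  apply (is_derive_eq _ _ _ _ (der_plus _ _ _ _ _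
           (der_plus _ _ _ _ _ (der_mult _ _ _ _ _ Hcx Hdx) (der_mult _ _ _ _ _ Hcy Hdy))
           (der_mult _ _ _ _ _ Hcz Hdz))).
  unfold dot; ring.
Qed.

Lemma is_dvec_cross (c d : R -> vec) (u : R) (c' d' : vec) :
  is_dvec c u c' -> is_dvec d u d' ->
  is_dvec (fun t => cross (c t) (d t)) u (plus (cross c' (d u)) (cross (c u) d')).
Proof.
  intros (Hcx & Hcy & Hcz) (Hdx & Hdy & Hdz).
  split; [| split].
  - apply (is_derive_eq _ _ _ _ (der_minus _ _ _ _ _
             (der_mult _ _ _ _ _ Hcy Hdz) (der_mult _ _ _ _ _ Hcz Hdy))).
    generalize (c u), (d u); intros; vec_ring.
  - apply (is_derive_eq _ _ _ _ (der_minus _ _ _ _ _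
             (der_mult _ _ _ _ _ Hcz Hdx) (der_mult _ _ _ _ _ Hcx Hdz))).
    generalize (c u), (d u); intros; vec_ring.
  - apply (is_derive_eq _ _ _ _ (der_minus _ _ _ _ _
             (der_mult _ _ _ _ _ Hcx Hdy) (der_mult _ _ _ _ _ Hcy Hdx))).
    generalize (c u), (d u); intros; vec_ring.
Qed.

Lemma is_dvec_continuous (c : R -> vec) (u : R) (d : vec) :
  is_dvec c u d -> vlim (locally u) c (c u).
Proof.
  intros (Hx & Hy & Hz); split; [| split].
  - apply (ex_derive_continuous (fun t => cx (c t))); eexists; exact Hx.
  - apply (ex_derive_continuous (fun t => cy (c t))); eexists; exact Hy.
  - apply (ex_derive_continuous (fun t => cz (c t))); eexists; exact Hz.
Qed.

Lemma Dvec_correct (c : R -> vec) (u : R) :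
  ex_derive (fun t => cx (c t)) u -> ex_derive (fun t => cy (c t)) u ->
  ex_derive (fun t => cz (c t)) u -> is_dvec c u (Dvec c u).
Proof.
  intros Hx Hy Hz.
  exact (conj (Derive_correct _ _ Hx) (conj (Derive_correct _ _ Hy) (Derive_correct _ _ Hz))).
Qed.

Lemma class_C3_derivatives (I : R -> Prop) (c : R -> vec) (u : R) :
  class_C_vec 3 I c -> I u ->
  is_dvec c u (Dvec c u) /\
  is_dvec (Dvec c) u (Dvec (Dvec c) u) /\
  is_dvec (Dvec (Dvec c)) u (Dvec (Dvec (Dvec c)) u).
Proof.
  intros (Hx & Hy & Hz) Hu.
  destruct (Hx u Hu) as [Kx _], (Hy u Hu) as [Ky _], (Hz u Hu) as [Kz _].
  assert (H1 : (1 <= 3)%nat) by auto.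
  assert (H2 : (2 <= 3)%nat) by auto.
  assert (H3 : (3 <= 3)%nat) by auto.
  split; [| split].
  - exact (Dvec_correct _ _ (Kx _ H1) (Ky _ H1) (Kz _ H1)).
  - exact (Dvec_correct (Dvec c) _ (Kx _ H2) (Ky _ H2) (Kz _ H2)).
  - exact (Dvec_correct (Dvec (Dvec c)) _ (Kx _ H3) (Ky _ H3) (Kz _ H3)).
Qed.

(** * The limit of the quadrics through three rulings *)

Definition twice_differentiable_vec (c c1 c2 : R -> vec) (u : R) : Prop :=
  locally u (fun t => is_dvec c t (c1 t) /\ is_dvec c1 t (c2 t)) /\ vlim (locally u) c2 (c2 u).

Definition vslope (c : R -> vec) (x y : R) : vec :=
  scal (/ (y - x)) (minus (c y) (c x)).
Definition second_vdifference (c : R -> vec) (x y z : R) : vec :=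
  scal (/ (z - y)) (minus (vslope c x z) (vslope c x y)).

Lemma newton_first (c : R -> vec) (x y : R) :
  x <> y -> c y = plus (c x) (scal (y - x) (vslope c x y)).
Proof.
  intros Hxy; unfold vslope; generalize (c x), (c y); intros p q.
  destruct p as [[? ?] ?], q as [[? ?] ?]; apply vec_ext; vec_expand; field; lra.
Qed.

Lemma newton_second (c : R -> vec) (x y z : R) :
  x <> y -> y <> z -> x <> z ->
  c z = plus (plus (c x) (scal (z - x) (vslope c x y)))
             (scal ((z - x) * (z - y)) (second_vdifference c x y z)).
Proof.
  intros Hxy Hyz Hxz; unfold second_vdifference, vslope; generalize (c x), (c y), (c z).
  intros p q r; destruct p as [[? ?] ?], q as [[? ?] ?], r as [[? ?] ?].
  apply vec_ext; vec_expand; field; repeat split; lra.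
Qed.

Lemma coalescing_limits (c c1 c2 : R -> vec) (u : R) :
  twice_differentiable_vec c c1 c2 u ->
  vlim (coalescing u) (fun t => c (fst (fst t))) (c u) /\
  vlim (coalescing u) (fun t => vslope c (fst (fst t)) (snd (fst t))) (c1 u) /\
  vlim (coalescing u) (fun t => second_vdifference c (fst (fst t)) (snd (fst t)) (snd t))
    (scal (/ 2) (c2 u)).
Proof.
  intros [Hd (Kx & Ky & Kz)].
  assert (Hx : twice_differentiable (fun t => cx (c t)) (fun t => cx (c1 t)) (fun t => cx (c2 t)) u).
  { split; [| exact Kx]; revert Hd; apply filter_imp; intros t [(H & _) (H' & _)]; now split. }
  assert (Hy : twice_differentiable (fun t => cy (c t)) (fun t => cy (c1 t)) (fun t => cy (c2 t)) u).
  { split; [| exact Ky]; revert Hd; apply filter_imp; intros t [(_ & H & _) (_ & H' & _)]; now split. }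
  assert (Hz : twice_differentiable (fun t => cz (c t)) (fun t => cz (c1 t)) (fun t => cz (c2 t)) u).
  { split; [| exact Kz]; revert Hd; apply filter_imp; intros t [(_ & _ & H) (_ & _ & H')]; now split. }
  split; [split; [| split] | split; [split; [| split] | split; [| split]]].
  - exact (first_node_limit _ _ _ _ Hx).
  - exact (first_node_limit _ _ _ _ Hy).
  - exact (first_node_limit _ _ _ _ Hz).
  - generalize (slope_limit _ _ _ _ Hx); apply filterlim_ext; intros t.
    apply Rmult_comm.
  - generalize (slope_limit _ _ _ _ Hy); apply filterlim_ext; intros t.
    apply Rmult_comm.
  - generalize (slope_limit _ _ _ _ Hz); apply filterlim_ext; intros t.
    apply Rmult_comm.
  - replace (cx (scal (/ 2) (c2 u))) with (cx (c2 u) / 2) by apply Rmult_comm.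
    generalize (second_difference_limit _ _ _ _ Hx); apply filterlim_ext; intros t.
    unfold second_difference, slope, Rdiv; rewrite Rmult_comm.
    rewrite (Rmult_comm _ (/ (snd t - _))), (Rmult_comm _ (/ (snd (fst t) - _))); reflexivity.
  - replace (cy (scal (/ 2) (c2 u))) with (cy (c2 u) / 2) by apply Rmult_comm.
    generalize (second_difference_limit _ _ _ _ Hy); apply filterlim_ext; intros t.
    unfold second_difference, slope, Rdiv; rewrite Rmult_comm.
    rewrite (Rmult_comm _ (/ (snd t - _))), (Rmult_comm _ (/ (snd (fst t) - _))); reflexivity.
  - replace (cz (scal (/ 2) (c2 u))) with (cz (c2 u) / 2) by apply Rmult_comm.
    generalize (second_difference_limit _ _ _ _ Hz); apply filterlim_ext; intros t.
    unfold second_difference, slope, Rdiv; rewrite Rmult_comm.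
    rewrite (Rmult_comm _ (/ (snd t - _))), (Rmult_comm _ (/ (snd (fst t) - _))); reflexivity.
Qed.

(** The second half of the Pluecker coordinates of a ruling. *)
Definition moment (s e : R -> vec) (t : R) : vec := cross (s t) (e t).

(** A point of a line spans no plane with it, so the corresponding column of
    [three_line_form] vanishes. *)
Lemma incident_moment (s e : R -> vec) (t v : R) :
  minus (cross (ruled s e t v) (e t)) (moment s e t) = zero.
Proof.
  unfold ruled, moment; generalize (s t), (e t); intros; vec_ring.
Qed.

(** Newton's formula expresses each of the three rulings as a combination of the
    divided differences, with nonzero coefficient at the highest one.  At a point
    of a ruling this combination of the columns of [three_line_form] is zero, so
    the determinant vanishes. *)
Lemma secant_quadric_contains (s e : R -> vec) (x y z : R) :
  x <> y -> y <> z -> x <> z ->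
  let Q := line_quadric (e x) (moment s e x) (vslope e x y) (vslope (moment s e) x y)
             (second_vdifference e x y z) (second_vdifference (moment s e) x y z) in
  contains_ruling Q s e x /\ contains_ruling Q s e y /\ contains_ruling Q s e z.
Proof.
  intros Hxy Hyz Hxz Q; unfold contains_ruling, Q.
  assert (det_zero : forall a b c : vec, a = zero -> det3 a b c = 0).
  { intros a b c ->; vec_ring. }
  repeat split; intros v; rewrite line_quadric_eval; unfold three_line_form.
  - now apply det_zero, incident_moment.
  - pose proof (incident_moment s e y v) as H.
    rewrite (newton_first e x y), (newton_first (moment s e) x y) in H by auto.
    set (p := ruled s e y v) in *; clearbody p.
    set (N1 := minus (cross p (e x)) (moment s e x)).
    set (N2 := minus (cross p (vslope e x y)) (vslope (moment s e) x y)).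
    generalize (minus (cross p (second_vdifference e x y z))
                  (second_vdifference (moment s e) x y z)); intros N3.
    assert (H' : plus N1 (scal (y - x) N2) = zero).
    { rewrite <- H; unfold N1, N2.
      generalize (e x), (moment s e x), (vslope e x y), (vslope (moment s e) x y); intros.
      vec_ring. }
    clearbody N1 N2.
    transitivity (det3 (plus N1 (scal (y - x) N2)) N2 N3); [vec_ring | now apply det_zero].
  - pose proof (incident_moment s e z v) as H.
    rewrite (newton_second e x y z), (newton_second (moment s e) x y z) in H by auto.
    set (p := ruled s e z v) in *; clearbody p.
    set (N1 := minus (cross p (e x)) (moment s e x)).
    set (N2 := minus (cross p (vslope e x y)) (vslope (moment s e) x y)).
    set (N3 := minus (cross p (second_vdifference e x y z))
                  (second_vdifference (moment s e) x y z)).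
    assert (H' : plus (plus N1 (scal (z - x) N2)) (scal ((z - x) * (z - y)) N3) = zero).
    { rewrite <- H; unfold N1, N2, N3.
      generalize (e x), (moment s e x), (vslope e x y), (vslope (moment s e) x y),
        (second_vdifference e x y z), (second_vdifference (moment s e) x y z); intros.
      vec_ring. }
    clearbody N1 N2 N3.
    transitivity (det3 (plus (plus N1 (scal (z - x) N2)) (scal ((z - x) * (z - y)) N3)) N2 N3);
      [vec_ring | now apply det_zero].
Qed.

(** The quadrics through three rulings are nonzero near the limit because their
    value at a fixed point [p] converges to a nonzero number. *)
Lemma osculating_quadric_of_tangents (I : R -> Prop) (s e e1 e2 m1 m2 : R -> vec) (u : R) (p : vec) :
  twice_differentiable_vec e e1 e2 u ->
  twice_differentiable_vec (moment s e) m1 m2 u ->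
  let Q := line_quadric (e u) (moment s e u) (e1 u) (m1 u) (scal (/ 2) (e2 u)) (scal (/ 2) (m2 u)) in
  quadric_eval Q p <> 0 ->
  osculating_quadric I s e u Q.
Proof.
  intros He Hm Q Hp; split.
  { exact (quadric_eval_nonzero _ _ Hp). }
  intros eps.
  destruct (coalescing_limits _ _ _ _ He) as (E1 & E2 & E3).
  destruct (coalescing_limits _ _ _ _ Hm) as (M1 & M2 & M3).
  pose proof (line_quadric_limit _ _ _ _ _ _ _ _ _ _ _ _ E1 M1 E2 M2 E3 M3) as Hlim.
  pose proof (line_quadric_eval_limit _ _ _ _ _ _ _ _ _ _ _ _ p E1 M1 E2 M2 E3 M3) as Hval.
  assert (Hnz : locally (quadric_eval Q p) (fun r => r <> 0)) by (apply (open_neq 0), Hp).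
  set (Q' := fun t : R * R * R =>
    line_quadric (e (fst (fst t))) (moment s e (fst (fst t)))
      (vslope e (fst (fst t)) (snd (fst t))) (vslope (moment s e) (fst (fst t)) (snd (fst t)))
      (second_vdifference e (fst (fst t)) (snd (fst t)) (snd t))
      (second_vdifference (moment s e) (fst (fst t)) (snd (fst t)) (snd t))).
  assert (Hnear : coalescing u (fun t => quadric_eval (Q' t) p <> 0 /\ ball Q eps (Q' t))).
  { apply filter_and.
    - exact (Hval (fun r => r <> 0) Hnz).
    - exact (proj1 (filterlim_locally _ _) Hlim eps). }
  destruct (coalescing_elim u _ Hnear) as [d Hd].
  exists d; intros x y z _ _ _ Hx Hy Hz Hxy Hyz Hxz.
  destruct (Hd x y z Hx Hy Hz Hxy Hyz Hxz) as [Hv Hb]; clear Hd.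
  exists (Q' (x, y, z)); split.
  - exact (quadric_eval_nonzero _ _ Hv).
  - destruct (secant_quadric_contains s e x y z Hxy Hyz Hxz) as (Cx & Cy & Cz).
    exact (conj Cx (conj Cy (conj Cz Hb))).
Qed.

(** * The striction frame *)

(** This is [param_distribution] times the invariant lambda. *)
Definition striction_component (s e : R -> vec) (u : R) : R := dot (Dvec s u) (e u).

Definition conical_curvature (e : R -> vec) (u : R) : R :=
  det3 (e u) (Dvec e u) (Dvec (Dvec e) u).

Lemma cross_frame (e n p q : vec) :
  orthonormal e n ->
  dot (cross p q) e = dot p n * dot q (cross e n) - dot p (cross e n) * dot q n /\
  dot (cross p q) n = dot p (cross e n) * dot q e - dot p e * dot q (cross e n) /\
  dot (cross p q) (cross e n) = dot p e * dot q n - dot p n * dot q e.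
Proof.
  intros Hf.
  assert (Hc : forall f, dot (cross p q) f = det3 f p q) by (intros; vec_ring).
  destruct (orthonormal_third _ _ Hf) as (Hzz & Hez & Hnz).
  pose proof Hf as (He & Hn & Hen).
  rewrite !Hc, !(det3_frame e n _ p q Hf).
  rewrite He, Hen, Hez, Hn, Hnz, Hzz, (dot_comm n e), Hen, !(dot_comm (cross e n)), Hez, Hnz.
  unfold det3; split; [| split]; unfold dot, cross, cx, cy, cz; simpl; ring.
Qed.

Lemma dot_derivative_constant (I : R -> Prop) (c d : R -> vec) (u k : R) (c' d' : vec) :
  open I -> I u -> (forall t, I t -> dot (c t) (d t) = k) ->
  is_dvec c u c' -> is_dvec d u d' -> dot c' (d u) + dot (c u) d' = 0.
Proof.
  intros HI Hu Hk Hc Hd.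
  rewrite <- (is_derive_unique _ _ _ (is_derive_dot c d u c' d' Hc Hd)).
  rewrite (Derive_ext_loc _ (fun _ => k)); [apply Derive_const |].
  generalize (HI u Hu); apply filter_imp; exact Hk.
Qed.

(** The coordinates of s', e', s'', e'' in the frame e, n = e', z = e x n, as far as
    they are determined by the invariants.  The last field says that the
    z-coordinate of s'' is the derivative of the parameter of distribution. *)
Record striction_frame (s e : R -> vec) (u : R) : Prop := {
  sf_orthonormal : orthonormal (e u) (Dvec e u);
  sf_ds_n : dot (Dvec s u) (Dvec e u) = 0;
  sf_dde_e : dot (Dvec (Dvec e) u) (e u) = -1;
  sf_dde_n : dot (Dvec (Dvec e) u) (Dvec e u) = 0;
  sf_dde_z : dot (Dvec (Dvec e) u) (cross (e u) (Dvec e u)) = conical_curvature e u;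
  sf_dds_n : dot (Dvec (Dvec s) u) (Dvec e u) =
    striction_component s e u - conical_curvature e u * param_distribution s e u;
  sf_delta : is_derive (param_distribution s e) u
    (dot (Dvec (Dvec s) u) (cross (e u) (Dvec e u)))
}.

Lemma skew_striction_frame (I : R -> Prop) (s e : R -> vec) (u : R) :
  open I -> skew_ruled_surface I s e -> I u -> striction_frame s e u.
Proof.
  intros HI H Hu.
  destruct (class_C3_derivatives _ _ _ (srs_C3_s _ _ _ H) Hu) as (Hs & Hs' & _).
  destruct (class_C3_derivatives _ _ _ (srs_C3_e _ _ _ H) Hu) as (He & He' & _).
  assert (unit_e : forall t, I t -> dot (e t) (e t) = 1)
    by (intros t Ht; now apply enorm_one, (srs_unit _ _ _ H)).
  assert (unit_n : forall t, I t -> dot (Dvec e t) (Dvec e t) = 1)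
    by (intros t Ht; now apply enorm_one, (srs_arclength _ _ _ H)).
  assert (orth : forall t, I t -> dot (e t) (Dvec e t) = 0).
  { intros t Ht.
    destruct (class_C3_derivatives _ _ _ (srs_C3_e _ _ _ H) Ht) as (Het & _).
    pose proof (dot_derivative_constant I e e t 1 _ _ HI Ht unit_e Het Het) as Hd.
    rewrite (dot_comm (Dvec e t)) in Hd; lra. }
  assert (Hf : orthonormal (e u) (Dvec e u)) by (repeat split; auto).
  assert (Hen : dot (Dvec (Dvec e) u) (e u) = -1).
  { pose proof (dot_derivative_constant I e (Dvec e) u 0 _ _ HI Hu orth He He') as Hd.
    rewrite (unit_n u Hu), dot_comm in Hd; lra. }
  assert (Hnn : dot (Dvec (Dvec e) u) (Dvec e u) = 0).
  { pose proof (dot_derivative_constant I _ _ u 1 _ _ HI Hu unit_n He' He') as Hd.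
    rewrite (dot_comm (Dvec e u)) in Hd; lra. }
  assert (Hnz : dot (Dvec (Dvec e) u) (cross (e u) (Dvec e u)) = conical_curvature e u).
  { unfold conical_curvature; rewrite <- det3_cyclic; reflexivity. }
  assert (Hsn : dot (Dvec s u) (Dvec e u) = 0) by now apply (srs_striction _ _ _ H).
  constructor; auto.
  - pose proof (dot_derivative_constant I _ _ u 0 _ _ HI Hu (srs_striction _ _ _ H) Hs' He') as Hd.
    rewrite (parseval _ _ (Dvec s u) (Dvec (Dvec e) u) Hf), Hen, Hnn, Hnz in Hd.
    unfold striction_component, param_distribution, det3; lra.
  - apply (is_derive_eq _ _ _ _ (is_derive_dot _ _ _ _ _ Hs' (is_dvec_cross _ _ _ _ _ He He'))).
    destruct (cross_frame _ _ (e u) (Dvec (Dvec e) u) Hf) as (C1 & C2 & C3).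
    destruct (orthonormal_third _ _ Hf) as (Hzz & Hez & Hnz').
    pose proof Hf as (H1 & H2 & H3).
    replace (plus (cross (Dvec e u) (Dvec e u)) (cross (e u) (Dvec (Dvec e) u)))
      with (cross (e u) (Dvec (Dvec e) u))
      by (generalize (e u), (Dvec e u), (Dvec (Dvec e) u); intros; vec_ring).
    rewrite (parseval _ _ (Dvec s u) (cross (e u) (Dvec (Dvec e) u)) Hf), C1, C2, C3.
    rewrite Hsn, Hen, Hnn, H1, H3, Hez; ring.
Qed.

(** * Osculating quadrics *)

(** In frame coordinates the columns of the determinant are (0, z, -y),
    (-z, -d, x) and half of (k y + 2 d, -k x - z - d', y - a - d k). *)
Lemma osculating_form (s e : R -> vec) (u : R) (p : vec) :
  striction_frame s e u ->
  let n := Dvec e u in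
  let w := minus p (s u) in
  let x := dot w (e u) in let y := dot w n in let z := dot w (cross (e u) n) in
  let a := striction_component s e u in
  let k := conical_curvature e u in
  let d := param_distribution s e u in
  let d' := dot (Dvec (Dvec s) u) (cross (e u) n) in
  three_line_form (e u) (moment s e u)
    n (plus (cross (Dvec s u) (e u)) (cross (s u) n))
    (scal (/ 2) (Dvec (Dvec e) u))
    (scal (/ 2) (plus (plus (cross (Dvec (Dvec s) u) (e u)) (cross (Dvec s u) n))
                      (plus (cross (Dvec s u) n) (cross (s u) (Dvec (Dvec e) u))))) p
  = / 2 * (- (a + d * k) * z ^ 2 + 2 * d * x * z - d * k * y ^ 2 - d' * y * z - 2 * d ^ 2 * y).
Proof.
  intros [Hf Hsn Hee Hen Hez Hssn _] n w x y z a k d d'.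
  unfold three_line_form.
  replace (minus (cross p (e u)) (moment s e u)) with (cross w (e u))
    by (unfold w, moment; generalize (s u), (e u); intros; vec_ring).
  replace (minus (cross p n) (plus (cross (Dvec s u) (e u)) (cross (s u) n)))
    with (minus (cross w n) (cross (Dvec s u) (e u)))
    by (unfold w, n; generalize (s u), (e u), (Dvec s u), (Dvec e u); intros; vec_ring).
  replace (minus (cross p (scal (/ 2) (Dvec (Dvec e) u))) _)
    with (scal (/ 2) (minus (cross w (Dvec (Dvec e) u))
            (plus (cross (Dvec (Dvec s) u) (e u)) (scal 2 (cross (Dvec s u) n)))))
    by (unfold w, n;
        generalize (s u), (e u), (Dvec s u), (Dvec e u), (Dvec (Dvec s) u), (Dvec (Dvec e) u);
        intros; vec_ring).
  fold n in Hf, Hsn, Hee, Hen, Hez, Hssn; fold a k d in Hssn; fold k in Hez.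
  assert (Ha : dot (Dvec s u) (e u) = a) by reflexivity.
  assert (Hd : dot (Dvec s u) (cross (e u) n) = d) by reflexivity.
  assert (Hd' : dot (Dvec (Dvec s) u) (cross (e u) n) = d') by reflexivity.
  rewrite (det3_frame _ _ _ _ _ Hf).
  rewrite !dot_scal_l, !dot_minus_l, !dot_plus_l, !dot_scal_l.
  rewrite !(fun q r => proj1 (cross_frame _ _ q r Hf)),
    !(fun q r => proj1 (proj2 (cross_frame _ _ q r Hf))),
    !(fun q r => proj2 (proj2 (cross_frame _ _ q r Hf))).
  destruct (orthonormal_third _ _ Hf) as (Kzz & Kez & Knz).
  destruct Hf as (Kee & Knn & Ken).
  rewrite (dot_comm n (e u)), Kee, Knn, Ken, Kez, Knz, Hsn, Hee, Hen, Hez, Hssn, Ha, Hd, Hd'.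
  fold x y z; clearbody x y z a k d d'.
  unfold det3, dot, cross, cx, cy, cz; simpl; field.
Qed.

(** With d' = 0 and a = - d / k the quadratic part of [osculating_form] has the
    eigenvalue k twice, up to a common factor, and the simple eigenvalue - 1 / k
    with eigenvector k e + z, which is the direction of the axis.  Completing the
    square in y puts the centre at s - (d / k) n; the gorge circle has radius
    |d / k|. *)
Lemma edlinger_of_invariants (I : R -> Prop) (s e : R -> vec) (u : R) :
  open I -> skew_ruled_surface I s e -> I u ->
  is_derive (param_distribution s e) u 0 ->
  param_distribution s e u + conical_curvature e u * striction_component s e u = 0 ->
  exists Q, osculating_quadric I s e u Q /\ rotational_hyperboloid Q.
Proof.
  intros HI H Hu Hdelta Hstr.
  pose proof (skew_striction_frame _ _ _ _ HI H Hu) as F.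
  assert (Hd' : dot (Dvec (Dvec s) u) (cross (e u) (Dvec e u)) = 0).
  { rewrite <- (is_derive_unique _ _ _ (sf_delta _ _ _ F)); exact (is_derive_unique _ _ _ Hdelta). }
  pose proof (srs_nontorsal _ _ _ H u Hu) as Hd.
  set (d := param_distribution s e u) in *.
  set (k := conical_curvature e u) in *.
  set (a := striction_component s e u) in *.
  assert (Hk : k <> 0) by (intros Hk; rewrite Hk in Hstr; lra).
  assert (Ha : a = - d / k) by (field_simplify_eq; lra).
  set (Q := line_quadric (e u) (moment s e u)
    (Dvec e u) (plus (cross (Dvec s u) (e u)) (cross (s u) (Dvec e u)))
    (scal (/ 2) (Dvec (Dvec e) u))
    (scal (/ 2) (plus (plus (cross (Dvec (Dvec s) u) (e u)) (cross (Dvec s u) (Dvec e u)))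
                      (plus (cross (Dvec s u) (Dvec e u)) (cross (s u) (Dvec (Dvec e) u)))))).
  set (c := minus (s u) (scal (d / k) (Dvec e u))).
  set (ax := scal (/ sqrt (1 + k ^ 2)) (plus (scal k (e u)) (cross (e u) (Dvec e u)))).
  assert (Hpos : 0 < 1 + k ^ 2) by nra.
  assert (Hsq : sqrt (1 + k ^ 2) ^ 2 = 1 + k ^ 2) by (apply pow2_sqrt; lra).
  assert (Hsq0 : sqrt (1 + k ^ 2) <> 0) by (apply Rgt_not_eq, sqrt_lt_R0; exact Hpos).
  assert (Hdk : d / k <> 0) by
    (now apply Rmult_integral_contrapositive_currified; [| apply Rinv_neq_0_compat]).
  assert (Hd3 : d ^ 3 / (2 * k) <> 0) by
    (apply Rmult_integral_contrapositive_currified;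
       [now apply pow_nonzero | apply Rinv_neq_0_compat; lra]).
  pose proof (sf_orthonormal _ _ _ F) as Hf.
  destruct (orthonormal_third _ _ Hf) as (Kzz & Kez & Knz).
  pose proof Hf as (Kee & Knn & Ken).
  assert (Hrot : forall p, let w := minus p c in
    quadric_eval Q p = (- (d ^ 3 / (2 * k))) *
      ((dot w w - dot w ax ^ 2) / Rabs (d / k) ^ 2 - dot w ax ^ 2 / Rabs d ^ 2 - 1)).
  { intros p w; unfold Q; rewrite line_quadric_eval, (osculating_form s e u p F).
    fold a k d; rewrite Hd'.
    assert (Hw : w = plus (minus p (s u)) (scal (d / k) (Dvec e u)))
      by (unfold w, c; generalize (s u), (Dvec e u); intros; clearbody d k; vec_ring).
    clearbody w; set (v := minus p (s u)) in *.
    assert (Hwe : dot w (e u) = dot v (e u))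
      by (rewrite Hw, dot_plus_l, dot_scal_l, (dot_comm (Dvec e u)), Ken; ring).
    assert (Hwn : dot w (Dvec e u) = dot v (Dvec e u) + d / k)
      by (rewrite Hw, dot_plus_l, dot_scal_l, Knn; ring).
    assert (Hwz : dot w (cross (e u) (Dvec e u)) = dot v (cross (e u) (Dvec e u)))
      by (rewrite Hw, dot_plus_l, dot_scal_l, Knz; ring).
    assert (Hwax : dot w ax ^ 2 =
      (k * dot v (e u) + dot v (cross (e u) (Dvec e u))) ^ 2 / (1 + k ^ 2)).
    { rewrite <- Hwe, <- Hwz, <- Hsq; unfold ax.
      rewrite dot_comm, dot_scal_l, dot_plus_l, dot_scal_l, (dot_comm (e u) w),
        (dot_comm (cross _ _) w); field; exact Hsq0. }
    rewrite !pow2_abs, Hwax, (parseval _ _ w w Hf), Hwe, Hwn, Hwz, Ha.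
    generalize (dot v (e u)), (dot v (Dvec e u)), (dot v (cross (e u) (Dvec e u))).
    intros x y z; clearbody d k; field; repeat split; lra. }
  exists Q; split.
  - destruct (class_C3_derivatives _ _ _ (srs_C3_s _ _ _ H) Hu) as (Ds & Ds' & Ds'').
    destruct (class_C3_derivatives _ _ _ (srs_C3_e _ _ _ H) Hu) as (De & De' & De'').
    apply (osculating_quadric_of_tangents I s e (Dvec e) (Dvec (Dvec e))
      (fun t => plus (cross (Dvec s t) (e t)) (cross (s t) (Dvec e t)))
      (fun t => plus (plus (cross (Dvec (Dvec s) t) (e t)) (cross (Dvec s t) (Dvec e t)))
                     (plus (cross (Dvec s t) (Dvec e t)) (cross (s t) (Dvec (Dvec e) t))))
      u c).
    + split; [| exact (is_dvec_continuous _ _ _ De'')].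
      generalize (HI u Hu); apply filter_imp; intros t Ht.
      destruct (class_C3_derivatives _ _ _ (srs_C3_e _ _ _ H) Ht) as (K1 & K2 & _).
      exact (conj K1 K2).
    + split.
      * generalize (HI u Hu); apply filter_imp; intros t Ht.
        destruct (class_C3_derivatives _ _ _ (srs_C3_s _ _ _ H) Ht) as (S1 & S2 & _).
        destruct (class_C3_derivatives _ _ _ (srs_C3_e _ _ _ H) Ht) as (E1 & E2 & _).
        split; [exact (is_dvec_cross _ _ _ _ _ S1 E1) |].
        exact (is_dvec_plus _ _ _ _ _ (is_dvec_cross _ _ _ _ _ S2 E1)
                 (is_dvec_cross _ _ _ _ _ S1 E2)).
      * apply is_dvec_continuous in Ds, Ds', Ds'', De, De', De''.
        exact (vlim_plus _ _ _ _
          (vlim_plus _ _ _ _ (vlim_cross _ _ _ _ Ds'' De) (vlim_cross _ _ _ _ Ds' De'))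
          (vlim_plus _ _ _ _ (vlim_cross _ _ _ _ Ds' De') (vlim_cross _ _ _ _ Ds De''))).
    + change (quadric_eval Q c <> 0); rewrite Hrot; cbv zeta.
      replace (minus c c) with (zero : vec) by (generalize c; intros; clear; vec_ring).
      replace (dot zero ax) with 0 by (generalize ax; intros; clear; vec_ring).
      replace (dot zero zero) with 0 by (clear; vec_ring).
      replace (- (d ^ 3 / (2 * k)) * _) with (d ^ 3 / (2 * k)) by (unfold Rdiv; ring).
      exact Hd3.
  - exists c, ax, (Rabs (d / k)), (Rabs d), (- (d ^ 3 / (2 * k))).
    split; [| split; [| split; [| split]]].
    + apply one_enorm; unfold ax.
      rewrite (parseval _ _ _ _ Hf), !dot_scal_l, !dot_plus_l, !dot_scal_l.
      rewrite (dot_comm (cross _ _) (e u)), (dot_comm (cross _ _) (Dvec e u)),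
        Kee, Ken, Kez, Knz, Kzz.
      transitivity ((k ^ 2 + 1) / sqrt (1 + k ^ 2) ^ 2); [field; exact Hsq0 |].
      rewrite Hsq; field; lra.
    + now apply Rabs_pos_lt.
    + now apply Rabs_pos_lt.
    + now apply Ropp_neq_0_compat.
    + exact Hrot.
Qed.

(** * The fundamental forms of a ruled surface *)

Lemma is_dvec_scal_const (k : R) (c : R -> vec) (u : R) (c' : vec) :
  is_dvec c u c' -> is_dvec (fun t => scal k (c t)) u (scal k c').
Proof.
  intros Hc.
  apply (is_dvec_eq _ _ _ _ (is_dvec_scal (fun _ => k) c u 0 c' (is_derive_const k u) Hc)).
  generalize (c u); intros; vec_ring.
Qed.

Lemma is_dvec_line (p q : vec) (v : R) : is_dvec (fun t => plus p (scal t q)) v q.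
Proof.
  apply (is_dvec_eq _ _ _ _ (is_dvec_plus _ _ _ _ _ (is_dvec_const p v)
    (is_dvec_scal (fun t => t) _ v 1 _ (is_derive_id v) (is_dvec_const q v)))).
  vec_ring.
Qed.

Lemma ruled_v (s e : R -> vec) (u v : R) : pdvec iv (ruled s e) u v = e u.
Proof. exact (is_dvec_unique _ _ _ (is_dvec_line (s u) (e u) v)). Qed.

Lemma ruled_u (I : R -> Prop) (s e : R -> vec) (u v : R) :
  skew_ruled_surface I s e -> I u ->
  pdvec iu (ruled s e) u v = plus (Dvec s u) (scal v (Dvec e u)).
Proof.
  intros H Hu.
  destruct (class_C3_derivatives _ _ _ (srs_C3_s _ _ _ H) Hu) as (Hs & _).
  destruct (class_C3_derivatives _ _ _ (srs_C3_e _ _ _ H) Hu) as (He & _).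
  exact (is_dvec_unique _ _ _ (is_dvec_plus _ _ _ _ _ Hs (is_dvec_scal_const v _ _ _ He))).
Qed.

(** The formulas for the surface hold only over [I], hence the localization. *)
Lemma pdvec_u_ext (I : R -> Prop) (Y : R -> R -> vec) (c : R -> vec) (u v : R) (c' : vec) :
  open I -> I u -> (forall t, I t -> Y t v = c t) -> is_dvec c u c' -> pdvec iu Y u v = c'.
Proof.
  intros HI Hu Heq Hc.
  apply (is_dvec_unique (fun t => Y t v)), (is_dvec_ext_loc c); [| exact Hc].
  generalize (HI u Hu); apply filter_imp; intros t Ht; symmetry; exact (Heq t Ht).
Qed.

Lemma pdvec_v_ext (Y : R -> R -> vec) (c : R -> vec) (u v : R) (c' : vec) :
  (forall t, Y u t = c t) -> is_dvec c v c' -> pdvec iv Y u v = c'.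
Proof.
  intros Heq Hc.
  apply (is_dvec_unique (fun t => Y u t)), (is_dvec_ext_loc c); [| exact Hc].
  apply filter_forall; intros t; symmetry; exact (Heq t).
Qed.

Lemma ruled_second (I : R -> Prop) (s e : R -> vec) (u v : R) :
  open I -> skew_ruled_surface I s e -> I u ->
  pdvec iu (pdvec iu (ruled s e)) u v = plus (Dvec (Dvec s) u) (scal v (Dvec (Dvec e) u)) /\
  pdvec iu (pdvec iv (ruled s e)) u v = Dvec e u /\
  pdvec iv (pdvec iu (ruled s e)) u v = Dvec e u /\
  pdvec iv (pdvec iv (ruled s e)) u v = zero.
Proof.
  intros HI H Hu.
  destruct (class_C3_derivatives _ _ _ (srs_C3_s _ _ _ H) Hu) as (_ & Hs' & _).
  destruct (class_C3_derivatives _ _ _ (srs_C3_e _ _ _ H) Hu) as (He & He' & _).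
  split; [| split; [| split]].
  - apply (pdvec_u_ext I _ (fun t => plus (Dvec s t) (scal v (Dvec e t)))); auto.
    + intros t Ht; now apply (ruled_u I).
    + exact (is_dvec_plus _ _ _ _ _ Hs' (is_dvec_scal_const v _ _ _ He')).
  - apply (pdvec_u_ext I _ e); auto; intros t _; apply ruled_v.
  - apply (pdvec_v_ext _ (fun t => plus (Dvec s u) (scal t (Dvec e u)))).
    + intros t; now apply (ruled_u I).
    + apply is_dvec_line.
  - apply (pdvec_v_ext _ (fun _ => e u)); [intros t; apply ruled_v | apply is_dvec_const].
Qed.

Lemma ruled_third (I : R -> Prop) (s e : R -> vec) (u v : R) :
  open I -> skew_ruled_surface I s e -> I u ->
  pdvec iu (pdvec iu (pdvec iv (ruled s e))) u v = Dvec (Dvec e) u /\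
  pdvec iu (pdvec iv (pdvec iu (ruled s e))) u v = Dvec (Dvec e) u /\
  pdvec iu (pdvec iv (pdvec iv (ruled s e))) u v = zero /\
  pdvec iv (pdvec iu (pdvec iv (ruled s e))) u v = zero /\
  pdvec iv (pdvec iv (pdvec iu (ruled s e))) u v = zero /\
  pdvec iv (pdvec iv (pdvec iv (ruled s e))) u v = zero.
Proof.
  intros HI H Hu.
  destruct (class_C3_derivatives _ _ _ (srs_C3_e _ _ _ H) Hu) as (_ & He' & _).
  split; [| split; [| split; [| split; [| split]]]].
  - apply (pdvec_u_ext I _ (Dvec e)); auto; intros t Ht.
    now destruct (ruled_second I s e t v HI H Ht) as (_ & E & _).
  - apply (pdvec_u_ext I _ (Dvec e)); auto; intros t Ht.
    now destruct (ruled_second I s e t v HI H Ht) as (_ & _ & E & _).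
  - apply (pdvec_u_ext I _ (fun _ => zero)); auto; [intros t Ht | apply is_dvec_const].
    now destruct (ruled_second I s e t v HI H Ht) as (_ & _ & _ & E).
  - apply (pdvec_v_ext _ (fun _ => Dvec e u)); [intros t | apply is_dvec_const].
    now destruct (ruled_second I s e u t HI H Hu) as (_ & E & _).
  - apply (pdvec_v_ext _ (fun _ => Dvec e u)); [intros t | apply is_dvec_const].
    now destruct (ruled_second I s e u t HI H Hu) as (_ & _ & E & _).
  - apply (pdvec_v_ext _ (fun _ => zero)); [intros t | apply is_dvec_const].
    now destruct (ruled_second I s e u t HI H Hu) as (_ & _ & _ & E).
Qed.

Definition normal_length (s e : R -> vec) (u v : R) : R :=
  sqrt (v ^ 2 + param_distribution s e u ^ 2).

Lemma normal_length_pos (I : R -> Prop) (s e : R -> vec) (u v : R) :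
  skew_ruled_surface I s e -> I u ->
  0 < normal_length s e u v /\
  normal_length s e u v ^ 2 = v ^ 2 + param_distribution s e u ^ 2.
Proof.
  intros H Hu; pose proof (srs_nontorsal _ _ _ H u Hu) as Hd.
  pose proof (pow2_gt_0 _ Hd) as Hd2; pose proof (pow2_ge_0 v) as Hv2.
  unfold normal_length; split; [apply sqrt_lt_R0 | apply pow2_sqrt]; lra.
Qed.

(** The cross product X_u x X_v is d n - v z, a vector of length [normal_length]. *)
Lemma dot_unit_normal (I : R -> Prop) (s e : R -> vec) (u v : R) (p : vec) :
  open I -> skew_ruled_surface I s e -> I u ->
  dot (unit_normal (ruled s e) u v) p =
  (param_distribution s e u * dot p (Dvec e u) - v * dot p (cross (e u) (Dvec e u)))
  / normal_length s e u v.
Proof.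
  intros HI H Hu.
  pose proof (skew_striction_frame _ _ _ _ HI H Hu) as F.
  pose proof (sf_orthonormal _ _ _ F) as Hf.
  destruct (orthonormal_third _ _ Hf) as (Kzz & Kez & Knz).
  assert (Hdot : forall q, dot (normal_dir (ruled s e) u v) q =
    param_distribution s e u * dot q (Dvec e u) - v * dot q (cross (e u) (Dvec e u))).
  { intros q; unfold normal_dir; rewrite (ruled_u I), ruled_v by auto.
    rewrite (parseval _ _ _ q Hf).
    destruct (cross_frame _ _ (plus (Dvec s u) (scal v (Dvec e u))) (e u) Hf) as (-> & -> & ->).
    rewrite !dot_plus_l, !dot_scal_l, (sf_ds_n _ _ _ F), Knz.
    destruct Hf as (-> & -> & ->); rewrite Kez.
    unfold param_distribution, det3; ring. }
  assert (Hn : enorm (normal_dir (ruled s e) u v) = normal_length s e u v).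
  { unfold enorm, normal_length; f_equal.
    rewrite Hdot, !Hdot, Kzz, Knz, (dot_comm (cross _ _) (Dvec e u)), Knz.
    destruct Hf as (_ & -> & _); ring. }
  unfold unit_normal; rewrite dot_scal_l, Hdot, Hn; apply Rmult_comm.
Qed.

(** The coefficient h_uu of the second fundamental form times [normal_length]. *)
Definition h_uu_numerator (s e : R -> vec) (u v : R) : R :=
  param_distribution s e u *
    (striction_component s e u - conical_curvature e u * param_distribution s e u)
  - v * Derive (param_distribution s e) u - v ^ 2 * conical_curvature e u.

Lemma second_form_ruled (I : R -> Prop) (s e : R -> vec) (u v : R) :
  open I -> skew_ruled_surface I s e -> I u ->
  second_form (ruled s e) iu iu u v = h_uu_numerator s e u v / normal_length s e u v /\
  second_form (ruled s e) iu iv u v = param_distribution s e u / normal_length s e u v /\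
  second_form (ruled s e) iv iu u v = param_distribution s e u / normal_length s e u v /\
  second_form (ruled s e) iv iv u v = 0.
Proof.
  intros HI H Hu; unfold second_form.
  destruct (ruled_second I s e u v HI H Hu) as (-> & -> & -> & ->).
  rewrite !(dot_unit_normal I) by auto.
  pose proof (skew_striction_frame _ _ _ _ HI H Hu) as F.
  pose proof (sf_orthonormal _ _ _ F) as Hf.
  destruct (orthonormal_third _ _ Hf) as (_ & _ & Knz).
  rewrite !dot_plus_l, !dot_scal_l, (sf_dds_n _ _ _ F), (sf_dde_n _ _ _ F), (sf_dde_z _ _ _ F), Knz.
  unfold h_uu_numerator; rewrite (is_derive_unique _ _ _ (sf_delta _ _ _ F)).
  destruct Hf as (_ & -> & _).
  assert (Hz : forall q, dot (zero : vec) q = 0) by (intros; vec_ring).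
  rewrite !Hz; unfold Rdiv; repeat split; ring.
Qed.

Lemma first_form_ruled (I : R -> Prop) (s e : R -> vec) (u v : R) :
  open I -> skew_ruled_surface I s e -> I u ->
  first_form (ruled s e) iu iu u v =
    striction_component s e u ^ 2 + param_distribution s e u ^ 2 + v ^ 2 /\
  first_form (ruled s e) iu iv u v = striction_component s e u /\
  first_form (ruled s e) iv iu u v = striction_component s e u /\
  first_form (ruled s e) iv iv u v = 1.
Proof.
  intros HI H Hu; unfold first_form; rewrite !(ruled_u I), !ruled_v by auto.
  pose proof (skew_striction_frame _ _ _ _ HI H Hu) as F.
  pose proof (sf_orthonormal _ _ _ F) as Hf.
  destruct (orthonormal_third _ _ Hf) as (_ & _ & Knz).
  rewrite (parseval _ _ (plus _ _) (plus _ _) Hf), (dot_comm (e u) (plus _ _)).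
  rewrite !dot_plus_l, !dot_scal_l, (sf_ds_n _ _ _ F), Knz, (dot_comm (Dvec e u) (e u)).
  destruct Hf as (-> & -> & ->).
  unfold striction_component, param_distribution, det3; repeat split; ring.
Qed.

Lemma gauss_curv_ruled (I : R -> Prop) (s e : R -> vec) (u v : R) :
  open I -> skew_ruled_surface I s e -> I u ->
  gauss_curv (ruled s e) u v =
  - (param_distribution s e u ^ 2 / (v ^ 2 + param_distribution s e u ^ 2) ^ 2).
Proof.
  intros HI H Hu; unfold gauss_curv, mdet.
  destruct (second_form_ruled I s e u v HI H Hu) as (_ & -> & -> & ->).
  destruct (first_form_ruled I s e u v HI H Hu) as (-> & -> & -> & ->).
  destruct (normal_length_pos I s e u v H Hu) as [Hw Hw2].
  rewrite <- Hw2.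
  replace (_ ^ 2 + param_distribution s e u ^ 2 + v ^ 2) with
    (striction_component s e u ^ 2 + normal_length s e u v ^ 2) by (rewrite Hw2; ring).
  field; repeat split; nra.
Qed.

(** * The Tchebychev covector *)

(** The partial derivatives of ln |K|. *)
Definition log_curv_grad (s e : R -> vec) (i : idx) (u v : R) : R :=
  let d := param_distribution s e u in
  match i with
  | iu => Derive (param_distribution s e) u * (2 * (v ^ 2 - d ^ 2)) / (d * (v ^ 2 + d ^ 2))
  | iv => - 4 * v / (v ^ 2 + d ^ 2)
  end.

Lemma is_derive_distribution (I : R -> Prop) (s e : R -> vec) (u : R) :
  open I -> skew_ruled_surface I s e -> I u ->
  is_derive (param_distribution s e) u (Derive (param_distribution s e) u).
Proof.
  intros HI H Hu.
  pose proof (sf_delta _ _ _ (skew_striction_frame _ _ _ _ HI H Hu)) as Hd.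
  apply Derive_correct; eexists; exact Hd.
Qed.

Definition partial (i : idx) (f : R -> R -> R) (u v l : R) : Prop :=
  match i with
  | iu => is_derive (fun t => f t v) u l
  | iv => is_derive (fun t => f u t) v l
  end.

Lemma partial_unique (i : idx) (f : R -> R -> R) (u v l : R) : partial i f u v l -> pd i f u v = l.
Proof. destruct i; apply is_derive_unique. Qed.

Lemma partial_ext (I : R -> Prop) (i : idx) (f g : R -> R -> R) (u v l : R) :
  open I -> I u -> (forall a b, I a -> f a b = g a b) -> partial i f u v l -> partial i g u v l.
Proof.
  intros HI Hu Heq; destruct i; simpl; apply is_derive_ext_loc.
  - generalize (HI u Hu); apply filter_imp; intros t Ht; now apply Heq.
  - apply filter_forall; intros t; now apply Heq.
Qed.

(** The absolute value of the Gaussian curvature. *)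
Definition curv_modulus (s e : R -> vec) (u v : R) : R :=
  param_distribution s e u ^ 2 / (v ^ 2 + param_distribution s e u ^ 2) ^ 2.

Lemma curv_modulus_pos (I : R -> Prop) (s e : R -> vec) (u v : R) :
  skew_ruled_surface I s e -> I u -> 0 < curv_modulus s e u v.
Proof.
  intros H Hu; pose proof (srs_nontorsal _ _ _ H u Hu) as Hd.
  pose proof (pow2_gt_0 _ Hd) as Hd2; pose proof (pow2_ge_0 v) as Hv2.
  apply Rdiv_lt_0_compat; [| apply pow_lt]; lra.
Qed.

Lemma curv_modulus_partial (I : R -> Prop) (s e : R -> vec) (i : idx) (u v : R) :
  open I -> skew_ruled_surface I s e -> I u ->
  partial i (curv_modulus s e) u v (curv_modulus s e u v * log_curv_grad s e i u v).
Proof.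
  intros HI H Hu; pose proof (srs_nontorsal _ _ _ H u Hu) as Hd.
  pose proof (is_derive_distribution I s e u HI H Hu) as Dd.
  pose proof (pow2_gt_0 _ Hd) as Hd2; pose proof (pow2_ge_0 v) as Hv2.
  destruct i; unfold curv_modulus, log_curv_grad; simpl.
  - set (d' := Derive (param_distribution s e) u) in *; clearbody d'.
    revert Hd Dd Hd2; generalize (param_distribution s e); intros d Hd Dd Hd2.
    auto_derive.
    + repeat split; try (eexists; exact Dd).
      exact (pow_nonzero (v ^ 2 + d u ^ 2) 2 ltac:(lra)).
    + replace (Derive (fun x => d x) u) with d' by (symmetry; exact (is_derive_unique d u d' Dd)).
      field; split; [lra | exact Hd].
  - generalize dependent (param_distribution s e u); intros d Hd Hd2.
    auto_derive; [| field; lra].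
    repeat split; exact (pow_nonzero (v ^ 2 + d ^ 2) 2 ltac:(lra)).
Qed.

Lemma gauss_curv_partial (I : R -> Prop) (s e : R -> vec) (i : idx) (u v : R) :
  open I -> skew_ruled_surface I s e -> I u ->
  pd i (gauss_curv (ruled s e)) u v =
  gauss_curv (ruled s e) u v * log_curv_grad s e i u v.
Proof.
  intros HI H Hu; apply partial_unique.
  rewrite (gauss_curv_ruled I) by auto; fold (curv_modulus s e u v).
  apply (partial_ext I i (fun a b => - curv_modulus s e a b)); auto.
  { intros t r Ht; symmetry; now apply (gauss_curv_ruled I). }
  pose proof (curv_modulus_partial I s e i u v HI H Hu) as Hp.
  rewrite Ropp_mult_distr_l_reverse.
  destruct i; exact (is_derive_opp _ _ _ Hp).
Qed.

Lemma support_partial (I : R -> Prop) (s e : R -> vec) (alpha : R) (i : idx) (u v : R) :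
  open I -> skew_ruled_surface I s e -> I u ->
  partial i (support (ruled s e) alpha) u v
    (alpha * log_curv_grad s e i u v * support (ruled s e) alpha u v).
Proof.
  intros HI H Hu.
  assert (Heq : forall a b, I a ->
    Rpower (curv_modulus s e a b) alpha = support (ruled s e) alpha a b).
  { intros t r Ht; unfold support; rewrite (gauss_curv_ruled I), Rabs_Ropp by auto.
    fold (curv_modulus s e t r); rewrite Rabs_pos_eq; [reflexivity |].
    now apply Rlt_le, (curv_modulus_pos I). }
  apply (partial_ext I i (fun a b => Rpower (curv_modulus s e a b) alpha)); auto.
  rewrite <- Heq by exact Hu.
  pose proof (curv_modulus_partial I s e i u v HI H Hu) as Hp.
  pose proof (curv_modulus_pos I s e u v H Hu) as Hpos.
  assert (chain : forall (f : R -> R) t l, 0 < f t -> is_derive f t (f t * l) ->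
    is_derive (fun r => Rpower (f r) alpha) t (alpha * l * Rpower (f t) alpha)).
  { intros f t l Hft Hd; unfold Rpower; auto_derive.
    - split; [eexists; exact Hd | split; [exact Hft | trivial]].
    - replace (Derive (fun x => f x) t) with (f t * l)
        by (symmetry; exact (is_derive_unique f t _ Hd)).
      field; lra. }
  destruct i.
  - exact (chain (fun t => curv_modulus s e t v) u _ Hpos Hp).
  - exact (chain (fun t => curv_modulus s e u t) v _ Hpos Hp).
Qed.

Lemma partial_quotient (i : idx) (q N W : R -> R -> R) (u v q' N' W' : R) :
  q u v <> 0 -> W u v <> 0 ->
  partial i q u v q' -> partial i N u v N' -> partial i W u v W' ->
  partial i (fun a b => / q a b * (N a b / W a b)) u v
    (/ q u v * (- q' / q u v * (N u v / W u v) + N' / W u v - N u v * W' / W u v ^ 2)).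
Proof.
  intros Hq HW Dq DN DW.
  assert (rule : forall (f g h : R -> R) t f' g' h', f t <> 0 -> h t <> 0 ->
    is_derive f t f' -> is_derive g t g' -> is_derive h t h' ->
    is_derive (fun r => / f r * (g r / h r)) t
      (/ f t * (- f' / f t * (g t / h t) + g' / h t - g t * h' / h t ^ 2))).
  { intros f g h t f' g' h' Hf Hh Df Dg Dh; auto_derive.
    - repeat split; try assumption; eexists; eassumption.
    - replace (Derive (fun x => f x) t) with f' by (symmetry; exact (is_derive_unique f t f' Df)).
      replace (Derive (fun x => g x) t) with g' by (symmetry; exact (is_derive_unique g t g' Dg)).
      replace (Derive (fun x => h x) t) with h' by (symmetry; exact (is_derive_unique h t h' Dh)).
      field; now split. }
  destruct i.
  - exact (rule (fun t => q t v) (fun t => N t v) (fun t => W t v) u _ _ _ Hq HW Dq DN DW).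
  - exact (rule (fun t => q u t) (fun t => N u t) (fun t => W u t) v _ _ _ Hq HW Dq DN DW).
Qed.

Lemma normal_length_partial (I : R -> Prop) (s e : R -> vec) (u v : R) :
  open I -> skew_ruled_surface I s e -> I u ->
  let d := param_distribution s e u in
  partial iu (normal_length s e) u v
    (d * Derive (param_distribution s e) u / normal_length s e u v) /\
  partial iv (normal_length s e) u v (v / normal_length s e u v).
Proof.
  intros HI H Hu d; destruct (normal_length_pos I s e u v H Hu) as [Hw Hw2].
  pose proof (is_derive_distribution I s e u HI H Hu) as Dd.
  assert (Hpos : 0 < v ^ 2 + d ^ 2) by (unfold d; rewrite <- Hw2; now apply pow_lt).
  unfold d in *; clear d Hw2.
  unfold normal_length in *; simpl; revert Hw Dd Hpos.
  generalize (param_distribution s e); intros d Hw Dd Hpos.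
  split; auto_derive.
  - repeat split; first [exact Hpos | eexists; exact Dd].
  - replace (Derive (fun x => d x) u) with (Derive d u) by reflexivity.
    simpl in *; field; lra.
  - exact Hpos.
  - simpl in *; field; lra.
Qed.

Lemma rel_metric_ruled (I : R -> Prop) (s e : R -> vec) (q : R -> R -> R) (u v : R) :
  open I -> skew_ruled_surface I s e -> I u ->
  rel_metric (ruled s e) q iu iu u v = / q u v * (h_uu_numerator s e u v / normal_length s e u v) /\
  rel_metric (ruled s e) q iu iv u v = / q u v * (param_distribution s e u / normal_length s e u v) /\
  rel_metric (ruled s e) q iv iu u v = / q u v * (param_distribution s e u / normal_length s e u v) /\
  rel_metric (ruled s e) q iv iv u v = 0.
Proof.
  intros HI H Hu; unfold rel_metric.
  destruct (second_form_ruled I s e u v HI H Hu) as (-> & -> & -> & ->).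
  rewrite Rmult_0_r; auto.
Qed.

(** The derivative of G_uu in the direction u is left out: it enters only the
    component A_uuu of the Darboux tensor, whose factor G^uu is zero because the
    rulings are asymptotic lines. *)
Lemma rel_metric_partials (I : R -> Prop) (s e : R -> vec) (q : R -> R -> R) (u v qu qv : R) :
  open I -> skew_ruled_surface I s e -> I u -> q u v <> 0 ->
  partial iu q u v qu -> partial iv q u v qv ->
  let X := ruled s e in
  let d := param_distribution s e u in
  let d' := Derive (param_distribution s e) u in
  let h := h_uu_numerator s e u v in
  let W := normal_length s e u v in
  let guv_u := / q u v * (- qu / q u v * (d / W) + d' / W - d * (d * d' / W) / W ^ 2) in
  let guv_v := / q u v * (- qv / q u v * (d / W) + 0 / W - d * (v / W) / W ^ 2) in
  pd iu (rel_metric X q iu iv) u v = guv_u /\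
  pd iu (rel_metric X q iv iu) u v = guv_u /\
  pd iv (rel_metric X q iu iv) u v = guv_v /\
  pd iv (rel_metric X q iv iu) u v = guv_v /\
  pd iv (rel_metric X q iu iu) u v =
    / q u v * (- qv / q u v * (h / W) + (- d' - 2 * v * conical_curvature e u) / W
               - h * (v / W) / W ^ 2) /\
  pd iu (rel_metric X q iv iv) u v = 0 /\
  pd iv (rel_metric X q iv iv) u v = 0.
Proof.
  intros HI H Hu Hq Dqu Dqv X d d' h W guv_u guv_v.
  destruct (normal_length_pos I s e u v H Hu) as [HW _]; apply Rgt_not_eq in HW.
  destruct (normal_length_partial I s e u v HI H Hu) as [DWu DWv].
  assert (Du : partial iu (fun a _ => param_distribution s e a) u v d')
    by now apply (is_derive_distribution I).
  assert (Dv : partial iv (fun a _ => param_distribution s e a) u v 0)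
    by exact (is_derive_const (param_distribution s e u) v).
  assert (Dh : partial iv (h_uu_numerator s e) u v (- d' - 2 * v * conical_curvature e u)).
  { unfold h_uu_numerator, d'; simpl; auto_derive; [trivial | ring]. }
  assert (Euv : forall a b, I a ->
    / q a b * (param_distribution s e a / normal_length s e a b) = rel_metric X q iu iv a b).
  { intros a b Ha; symmetry; now apply (rel_metric_ruled I). }
  assert (Evu : forall a b, I a ->
    / q a b * (param_distribution s e a / normal_length s e a b) = rel_metric X q iv iu a b).
  { intros a b Ha; symmetry; now apply (rel_metric_ruled I). }
  assert (Euu : forall a b, I a ->
    / q a b * (h_uu_numerator s e a b / normal_length s e a b) = rel_metric X q iu iu a b).
  { intros a b Ha; symmetry; now apply (rel_metric_ruled I). }
  assert (Evv : forall a b, I a -> (fun _ _ => 0) a b = rel_metric X q iv iv a b).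
  { intros a b Ha; symmetry; now apply (rel_metric_ruled I). }
  split; [| split; [| split; [| split; [| split; [| split]]]]]; apply partial_unique.
  - apply (partial_ext I _ _ _ _ _ _ HI Hu Euv).
    exact (partial_quotient iu _ _ _ _ _ _ _ _ Hq HW Dqu Du DWu).
  - apply (partial_ext I _ _ _ _ _ _ HI Hu Evu).
    exact (partial_quotient iu _ _ _ _ _ _ _ _ Hq HW Dqu Du DWu).
  - apply (partial_ext I _ _ _ _ _ _ HI Hu Euv).
    exact (partial_quotient iv _ _ _ _ _ _ _ _ Hq HW Dqv Dv DWv).
  - apply (partial_ext I _ _ _ _ _ _ HI Hu Evu).
    exact (partial_quotient iv _ _ _ _ _ _ _ _ Hq HW Dqv Dv DWv).
  - apply (partial_ext I _ _ _ _ _ _ HI Hu Euu).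
    exact (partial_quotient iv _ _ _ _ _ _ _ _ Hq HW Dqv Dh DWv).
  - apply (partial_ext I _ _ _ _ _ _ HI Hu Evv); exact (is_derive_const 0 u).
  - apply (partial_ext I _ _ _ _ _ _ HI Hu Evv); exact (is_derive_const 0 v).
Qed.

(** The Tchebychev covector is d ln q - d ln |K| / 4; it vanishes for the affine
    normal, whose support function is q = |K|^(1/4). *)
Lemma tcheb_cov_ruled (I : R -> Prop) (s e : R -> vec) (q : R -> R -> R) (i : idx)
    (u v qu qv : R) :
  open I -> skew_ruled_surface I s e -> I u -> q u v <> 0 ->
  partial iu q u v qu -> partial iv q u v qv ->
  tcheb_cov (ruled s e) q i u v =
  match i with iu => qu | iv => qv end / q u v - log_curv_grad s e i u v / 4.
Proof.
  intros HI H Hu Hq Dqu Dqv.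
  pose proof (srs_nontorsal _ _ _ H u Hu) as Hd.
  destruct (normal_length_pos I s e u v H Hu) as [HW HW2]; apply Rgt_not_eq in HW.
  pose proof (skew_striction_frame _ _ _ _ HI H Hu) as F.
  unfold tcheb_cov, rel_metric_inv, minv, mdet, sum2, darboux.
  destruct (rel_metric_partials I s e q u v qu qv HI H Hu Hq Dqu Dqv)
    as (P1 & P2 & P3 & P4 & P5 & P6 & P7).
  destruct (rel_metric_ruled I s e q u v HI H Hu) as (G1 & G2 & G3 & G4).
  destruct (ruled_third I s e u v HI H Hu) as (X1 & X2 & X3 & X4 & X5 & X6).
  assert (Hz : forall r, dot (zero : vec) r = 0) by (intros; vec_ring).
  unfold log_curv_grad.
  replace (v ^ 2 - param_distribution s e u ^ 2) with
    (normal_length s e u v ^ 2 - 2 * param_distribution s e u ^ 2) by (rewrite HW2; ring).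
  destruct i; rewrite ?P1, ?P2, ?P3, ?P4, ?P5, ?P6, ?P7, ?G1, ?G2, ?G3, ?G4;
    rewrite ?X1, ?X2, ?X3, ?X4, ?X5, ?X6, !(dot_unit_normal I s e u v) by auto;
    rewrite ?(sf_dde_n _ _ _ F), ?(sf_dde_z _ _ _ F), ?Hz, <- HW2; field; auto.
Qed.

Lemma tcheb_cov_support (I : R -> Prop) (s e : R -> vec) (alpha : R) (i : idx) (u v : R) :
  open I -> skew_ruled_surface I s e -> I u ->
  tcheb_cov (ruled s e) (support (ruled s e) alpha) i u v =
  (alpha - 1 / 4) * log_curv_grad s e i u v.
Proof.
  intros HI H Hu.
  assert (Hq : support (ruled s e) alpha u v <> 0) by apply Rgt_not_eq, exp_pos.
  rewrite (tcheb_cov_ruled I s e _ i u v _ _ HI H Hu Hq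
    (support_partial I s e alpha iu u v HI H Hu) (support_partial I s e alpha iv u v HI H Hu)).
  destruct i; field; exact Hq.
Qed.

(** * The Tchebychev vector *)

(** Raising an index with G and lowering it with h = q G multiplies it by q. *)
Lemma second_form_tcheb (I : R -> Prop) (s e : R -> vec) (q : R -> R -> R) (i : idx) (u v : R) :
  open I -> skew_ruled_surface I s e -> I u -> q u v <> 0 ->
  sum2 (fun j => second_form (ruled s e) i j u v * tcheb (ruled s e) q j u v) =
  q u v * tcheb_cov (ruled s e) q i u v.
Proof.
  intros HI H Hu Hq.
  pose proof (srs_nontorsal _ _ _ H u Hu) as Hd.
  destruct (normal_length_pos I s e u v H Hu) as [HW _]; apply Rgt_not_eq in HW.
  unfold tcheb, rel_metric_inv, minv, mdet, sum2.
  destruct (rel_metric_ruled I s e q u v HI H Hu) as (-> & -> & -> & ->).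
  destruct (second_form_ruled I s e u v HI H Hu) as (E1 & E2 & E3 & E4).
  destruct i; rewrite ?E1, ?E2, ?E3, ?E4; field; auto.
Qed.

Definition lowered (X : R -> R -> vec) (W : idx -> R -> R -> R) (i : idx) (u v : R) : R :=
  sum2 (fun j => first_form X i j u v * W j u v).

Lemma dot_tangent_vec (X : R -> R -> vec) (W : idx -> R -> R -> R) (u v a b : R) :
  dot (tangent_vec X W u v) (plus (scal a (pdvec iu X u v)) (scal b (pdvec iv X u v))) =
  a * lowered X W iu u v + b * lowered X W iv u v.
Proof.
  unfold tangent_vec, lowered, sum2, first_form.
  generalize (pdvec iu X u v), (pdvec iv X u v), (W iu u v), (W iv u v); intros; vec_ring.
Qed.

(** Both components share the nonzero factor [c], so the orthogonality conditions
    concern only the remaining factors, which are rational in v. *)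
Lemma lowered_tcheb (I : R -> Prop) (s e : R -> vec) (alpha u v : R) :
  open I -> skew_ruled_surface I s e -> I u ->
  let X := ruled s e in
  let T := tcheb X (support X alpha) in
  let a := striction_component s e u in
  let d := param_distribution s e u in
  let Lu := log_curv_grad s e iu u v in
  let Lv := log_curv_grad s e iv u v in
  let r := Lu - h_uu_numerator s e u v / d * Lv in
  let c := support X alpha u v * (alpha - 1 / 4) * normal_length s e u v / d in
  lowered X T iu u v = c * ((a ^ 2 + d ^ 2 + v ^ 2) * Lv + a * r) /\
  lowered X T iv u v = c * (a * Lv + r).
Proof.
  intros HI H Hu X T a d Lu Lv r c.
  pose proof (srs_nontorsal _ _ _ H u Hu) as Hd; fold d in Hd.
  assert (Hq : support (ruled s e) alpha u v <> 0) by apply Rgt_not_eq, exp_pos.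
  destruct (normal_length_pos I s e u v H Hu) as [HW _]; apply Rgt_not_eq in HW.
  unfold lowered, T, X, tcheb, rel_metric_inv, minv, mdet, sum2.
  destruct (first_form_ruled I s e u v HI H Hu) as (-> & -> & -> & ->).
  destruct (rel_metric_ruled I s e (support (ruled s e) alpha) u v HI H Hu) as (-> & -> & -> & ->).
  rewrite !(tcheb_cov_support I) by auto.
  unfold r, c, X; fold a d Lu Lv; split; field; auto.
Qed.

Lemma lowered_coefficient_nonzero (I : R -> Prop) (s e : R -> vec) (alpha u v : R) :
  skew_ruled_surface I s e -> I u -> alpha <> 1 / 4 ->
  support (ruled s e) alpha u v * (alpha - 1 / 4) * normal_length s e u v
    / param_distribution s e u <> 0.
Proof.
  intros H Hu Halpha; destruct (normal_length_pos I s e u v H Hu) as [HW _].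
  repeat apply Rmult_integral_contrapositive_currified.
  - apply Rgt_not_eq, exp_pos.
  - lra.
  - now apply Rgt_not_eq.
  - apply Rinv_neq_0_compat, (srs_nontorsal _ _ _ H u Hu).
Qed.

(** * The invariants of the surface *)

(** The second equation is 1 + kappa lambda = 0 multiplied by the parameter of
    distribution: the line of striction is a line of curvature. *)
Definition edlinger_invariants (I : R -> Prop) (s e : R -> vec) : Prop :=
  forall u, I u ->
    Derive (param_distribution s e) u = 0 /\
    param_distribution s e u + conical_curvature e u * striction_component s e u = 0.

(** Orthogonality to X_u is a cubic equation in v: the coefficient of v^3 gives
    d + k a = 0, hence a <> 0, and the constant term gives a d' = 0. *)
Lemma invariants_of_striction_distance (I : R -> Prop) (s e : R -> vec) (alpha : R) :
  open I -> skew_ruled_surface I s e -> alpha <> 1 / 4 ->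
  orthogonal_to_level_curves I (ruled s e) (tcheb (ruled s e) (support (ruled s e) alpha))
    (fun _ v => v) ->
  edlinger_invariants I s e.
Proof.
  intros HI H Halpha Horth u Hu.
  pose proof (srs_nontorsal _ _ _ H u Hu) as Hd.
  set (d := param_distribution s e u) in *.
  set (d' := Derive (param_distribution s e) u).
  set (k := conical_curvature e u).
  set (a := striction_component s e u).
  assert (poly : forall v, - 4 * v * d * (a ^ 2 + d ^ 2 + v ^ 2)
    + a * (2 * d' * (v ^ 2 - d ^ 2) + 4 * v * (d * (a - k * d) - v * d' - v ^ 2 * k)) = 0).
  { intros v.
    assert (Dv : pd iv (fun _ b : R => b) u v = 1) by apply (Derive_id v).
    assert (Du : pd iu (fun _ b : R => b) u v = 0) by apply (Derive_const v u).
    assert (Hne : pd iu (fun _ b : R => b) u v <> 0 \/ pd iv (fun _ b : R => b) u v <> 0)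
      by (right; rewrite Dv; lra).
    assert (Ht : 1 * pd iu (fun _ b : R => b) u v + 0 * pd iv (fun _ b : R => b) u v = 0)
      by (rewrite Du; ring).
    pose proof (Horth u v Hu Hne 1 0 Ht) as E.
    rewrite dot_tangent_vec, Rmult_1_l, Rmult_0_l, Rplus_0_r in E.
    rewrite (proj1 (lowered_tcheb I s e alpha u v HI H Hu)) in E.
    apply Rmult_integral in E.
    destruct E as [E | E];
      [exfalso; exact (lowered_coefficient_nonzero I s e alpha u v H Hu Halpha E) |].
    unfold log_curv_grad, h_uu_numerator in E; fold d k a d' in E.
    assert (Hw : v ^ 2 + d ^ 2 <> 0) by nra.
    apply (f_equal (Rmult (d * (v ^ 2 + d ^ 2)))) in E.
    rewrite Rmult_0_r in E; rewrite <- E; field; now split. }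
  (* The values at five points determine the coefficients of the cubic. *)
  pose proof (poly 0) as P0; pose proof (poly 1) as P1; pose proof (poly (-1)) as P2;
    pose proof (poly 2) as P3; pose proof (poly (-2)) as P4; clear poly.
  assert (Hdk : d + k * a = 0) by lra.
  split; [| exact Hdk].
  assert (Ha : a <> 0) by (intros Ha; rewrite Ha in Hdk; lra).
  assert (Hprod : a * d' * d ^ 2 = 0) by lra.
  apply Rmult_integral in Hprod; destruct Hprod as [Hprod | Hprod].
  - apply Rmult_integral in Hprod; destruct Hprod; [contradiction | assumption].
  - now apply (pow_nonzero d 2) in Hd.
Qed.

(** Orthogonality to the level curves of K is an equation of degree 5 in v: the
    constant term gives d' = 0, and then the coefficient of v^4 gives
    d (d + k a) = 0. *)
Lemma invariants_of_K_curves (I : R -> Prop) (s e : R -> vec) (alpha : R) :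
  open I -> skew_ruled_surface I s e -> alpha <> 1 / 4 ->
  orthogonal_to_level_curves I (ruled s e) (tcheb (ruled s e) (support (ruled s e) alpha))
    (gauss_curv (ruled s e)) ->
  edlinger_invariants I s e.
Proof.
  intros HI H Halpha Horth u Hu.
  pose proof (srs_nontorsal _ _ _ H u Hu) as Hd.
  set (d := param_distribution s e u) in *.
  set (d' := Derive (param_distribution s e) u).
  set (k := conical_curvature e u).
  set (a := striction_component s e u).
  assert (poly : forall v, v <> 0 ->
    16 * v ^ 2 * d ^ 2 * (a ^ 2 + d ^ 2 + v ^ 2) - (2 * d' * (v ^ 2 - d ^ 2)) ^ 2
    - (16 * v ^ 2 * a * d + 4 * v * (2 * d' * (v ^ 2 - d ^ 2)))
      * (d * (a - k * d) - v * d' - v ^ 2 * k) = 0).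
  { intros v Hv.
    assert (HK : gauss_curv (ruled s e) u v <> 0).
    { rewrite (gauss_curv_ruled I) by auto.
      apply Ropp_neq_0_compat, Rgt_not_eq, (curv_modulus_pos I s e u v H Hu). }
    assert (Hw : v ^ 2 + d ^ 2 <> 0) by nra.
    assert (HLv : log_curv_grad s e iv u v <> 0).
    { apply Rmult_integral_contrapositive_currified; [lra | now apply Rinv_neq_0_compat]. }
    assert (Hne : pd iu (gauss_curv (ruled s e)) u v <> 0 \/
                  pd iv (gauss_curv (ruled s e)) u v <> 0).
    { right; rewrite (gauss_curv_partial I) by auto.
      now apply Rmult_integral_contrapositive_currified. }
    assert (Ht : log_curv_grad s e iv u v * pd iu (gauss_curv (ruled s e)) u v
                 + - log_curv_grad s e iu u v * pd iv (gauss_curv (ruled s e)) u v = 0)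
      by (rewrite !(gauss_curv_partial I) by auto; ring).
    pose proof (Horth u v Hu Hne _ _ Ht) as E.
    rewrite dot_tangent_vec in E.
    destruct (lowered_tcheb I s e alpha u v HI H Hu) as [E1 E2].
    rewrite E1, E2 in E; clear E1 E2.
    pose proof (lowered_coefficient_nonzero I s e alpha u v H Hu Halpha) as Hc.
    fold d a in E; fold d in Hc.
    set (c := support (ruled s e) alpha u v * (alpha - 1 / 4) * normal_length s e u v / d) in *.
    clearbody c.
    apply (Rmult_eq_reg_l c); [| exact Hc]; rewrite Rmult_0_r.
    apply (f_equal (Rmult (d ^ 2 * (v ^ 2 + d ^ 2) ^ 2))) in E.
    rewrite Rmult_0_r in E; rewrite <- E.
    unfold log_curv_grad, h_uu_numerator; fold d k a d'; field; now split. }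
  (* At v = 0 the differential of K may vanish, so the coefficients are read off from
     nonzero values of v; symmetric ones separate the even part, of degree 4. *)
  pose proof (poly 1 ltac:(lra)) as P1; pose proof (poly (-1) ltac:(lra)) as P2;
    pose proof (poly 2 ltac:(lra)) as P3; pose proof (poly (-2) ltac:(lra)) as P4;
    pose proof (poly 3 ltac:(lra)) as P5; pose proof (poly (-3) ltac:(lra)) as P6; clear poly.
  assert (Hprod : d' ^ 2 * d ^ 4 = 0) by lra.
  assert (Hd' : d' = 0).
  { apply Rmult_integral in Hprod; destruct Hprod as [Hprod | Hprod].
    - now apply Rsqr_0_uniq; rewrite Rsqr_pow2.
    - now apply (pow_nonzero d 4) in Hd. }
  split; [exact Hd' |].
  rewrite Hd' in *.
  assert (Hdk : d * (d + k * a) = 0) by lra.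
  apply Rmult_integral in Hdk; destruct Hdk; [contradiction | assumption].
Qed.

(** A principal vector T satisfies h T = kap g T, while h T is a multiple of d ln |K|.
    So g T annihilates the kernel of dK, unless [kap] vanishes, and it cannot vanish
    where dK does not. *)
Lemma K_curves_of_principal (I : R -> Prop) (s e : R -> vec) (alpha : R) (kap : R -> R -> R) :
  open I -> skew_ruled_surface I s e -> alpha <> 1 / 4 ->
  principal_for I (ruled s e) (tcheb (ruled s e) (support (ruled s e) alpha)) kap ->
  orthogonal_to_level_curves I (ruled s e) (tcheb (ruled s e) (support (ruled s e) alpha))
    (gauss_curv (ruled s e)).
Proof.
  intros HI H Halpha Hprin u v Hu Hne a b Hab.
  rewrite dot_tangent_vec.
  set (X := ruled s e) in *; set (T := tcheb X (support X alpha)) in *.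
  assert (Hq : support X alpha u v <> 0) by apply Rgt_not_eq, exp_pos.
  assert (HL : forall i, support X alpha u v * ((alpha - 1 / 4) * log_curv_grad s e i u v)
                         = kap u v * lowered X T i u v).
  { intros i; rewrite <- (tcheb_cov_support I s e alpha i u v HI H Hu); fold X.
    pose proof (second_form_tcheb I s e (support X alpha) i u v HI H Hu Hq) as C.
    fold X in C; rewrite <- C.
    pose proof (Hprin u v Hu i) as E; unfold sum2 in E.
    unfold lowered, sum2; fold X T; lra. }
  assert (HK : gauss_curv X u v <> 0).
  { unfold X; rewrite (gauss_curv_ruled I) by auto.
    apply Ropp_neq_0_compat, Rgt_not_eq, (curv_modulus_pos I s e u v H Hu). }
  unfold X in Hne, Hab; rewrite !(gauss_curv_partial I) in Hne by auto.
  rewrite !(gauss_curv_partial I) in Hab by auto; fold X in Hne, Hab.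
  assert (Hk : kap u v <> 0).
  { intros Hk.
    assert (Hzero : forall i, log_curv_grad s e i u v = 0).
    { intros i; pose proof (HL i) as E; rewrite Hk, Rmult_0_l in E.
      apply Rmult_integral in E; destruct E as [E | E]; [contradiction |].
      apply Rmult_integral in E; destruct E as [E | E]; [lra | exact E]. }
    rewrite !Hzero, Rmult_0_r in Hne; destruct Hne as [Hne | Hne]; now apply Hne. }
  apply (Rmult_eq_reg_l (kap u v)); [| exact Hk]; rewrite Rmult_0_r.
  assert (Hab' : a * log_curv_grad s e iu u v + b * log_curv_grad s e iv u v = 0).
  { apply (Rmult_eq_reg_l (gauss_curv X u v)); [| exact HK].
    rewrite Rmult_0_r, <- Hab; ring. }
  transitivity (a * (kap u v * lowered X T iu u v) + b * (kap u v * lowered X T iv u v)); [ring |].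
  rewrite <- !HL.
  transitivity (support X alpha u v * (alpha - 1 / 4)
    * (a * log_curv_grad s e iu u v + b * log_curv_grad s e iv u v)); [ring |].
  rewrite Hab'; ring.
Qed.

Theorem proposition3 :
  forall (a b : Rbar) (s e : R -> vec) (alpha : R),
    Rbar_lt a b ->
    skew_ruled_surface (Rbar_interval a b) s e ->
    alpha <> 1 / 4 ->
    let I := Rbar_interval a b in
    let X := ruled s e in
    let T := tcheb X (support X alpha) in
    (orthogonal_to_level_curves I X T (fun _ v => v) \/
     orthogonal_to_level_curves I X T (gauss_curv X) \/
     tangent_to_family_of_curvature_lines I X T) ->
    edlinger I s e.
Proof.
  intros a b s e alpha _ H Halpha I X T Hcases.
  assert (HI : open I) by (apply open_and; [apply open_Rbar_gt | apply open_Rbar_lt]).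
  assert (Hinv : edlinger_invariants I s e).
  { destruct Hcases as [Hv | [HK | [Hmax | Hmin]]].
    - now apply (invariants_of_striction_distance I s e alpha).
    - now apply (invariants_of_K_curves I s e alpha).
    - apply (invariants_of_K_curves I s e alpha); auto.
      now apply (K_curves_of_principal I s e alpha (max_principal_curv X)).
    - apply (invariants_of_K_curves I s e alpha); auto.
      now apply (K_curves_of_principal I s e alpha (min_principal_curv X)). }
  intros u Hu; destruct (Hinv u Hu) as [Hd Hstr].
  apply edlinger_of_invariants; auto.
  rewrite <- Hd; now apply (is_derive_distribution I).
Qed.
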